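(* Let $G$ be a finite group. Then $G$ is solvable if and only if $\mathrm{minmaxl}(G)=\mathrm{modl}(G)$.
   Context: For a finite group $G$, $\mathcal{L}(G)$ denotes the lattice of all subgroups of $G$ ordered by inclusion, with meet $H\wedge K=H\cap K$ and join $H\vee K=\langle H,K\rangle$. A chain in $\mathcal{L}(G)$ is a subset totally ordered by inclusion; it is maximal if it is not properly contained in any other chain (so a maximal chain contains $1$ and $G$). The length of a chain is its number of elements minus one. An element $m$ of a lattice $L$ is modular in $L$ if both (i) $x\vee(m\wedge y)=(x\vee m)\wedge y$ for all $x,y\in L$ with $x\le y$, and (ii) $m\vee(x\wedge n)=(m\vee x)\wedge n$ for all $x,n\in L$ with $m\le n$. $\mathrm{minmaxl}(G)$ is the minimum length of a maximal chain in $\mathcal{L}(G)$. $\mathrm{modl}(G)$ is the maximum length of a chain in $\mathcal{L}(G)$ all of whose elements are modular in $\mathcal{L}(G)$. *)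

(* Defs.v *)
From mathcomp Require Import all_boot all_fingroup all_solvable.

Set Implicit Arguments.
Unset Strict Implicit.
Unset Printing Implicit Defensive.

Local Open Scope group_scope.

Section SubgroupLattice.

Variables (gT : finGroupType) (G : {group gT}).

Definition subgroup_chain (C : {set {group gT}}) : bool :=
  (C \subset subgroups G)
  && [forall H in C, forall K in C, (H \subset K) || (K \subset H)].

Definition max_subgroup_chain (C : {set {group gT}}) : bool :=
  maxset subgroup_chain C.

(* The truncation only matters for the empty chain, which is assigned length
   0; so is the chain {1}, all of whose elements are modular. *)
Definition chain_length (C : {set {group gT}}) : nat := #|C|.-1.

(* Meets and joins in the subgroup lattice of G are :&: and <*>. *)
Definition modular_subgroup (M : {group gT}) : bool :=
  [&& M \in subgroups G,
      [forall X in subgroups G, forall Y in subgroups G,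
         (X \subset Y) ==> (X <*> (M :&: Y) == (X <*> M) :&: Y)]
    & [forall X in subgroups G, forall N in subgroups G,
         (M \subset N) ==> (M <*> (X :&: N) == (M <*> X) :&: N)]].

Lemma max_subgroup_chain_length_exists :
  exists n, [exists C, max_subgroup_chain C && (chain_length C == n)].
Proof.
have chain0 : subgroup_chain set0.
  rewrite /subgroup_chain sub0set; apply/forall_inP => H.
  by rewrite inE.
have [C maxC _] := maxset_exists chain0.
by exists (chain_length C); apply/existsP; exists C; rewrite eqxx andbT.
Qed.

Definition minmaxl : nat := ex_minn max_subgroup_chain_length_exists.

Definition modl : nat :=
  \max_(C | subgroup_chain C && [forall M in C, modular_subgroup M])
     chain_length C.

End SubgroupLattice.

(* Main.v *)
Require Import Defs.
From mathcomp Require Import all_boot all_fingroup all_solvable.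

(* Let [c] be the length of a chief series of [G]. Given a chain
   [1 = x_0 < ... < x_n = G], call [i] a jump of [M] when [x_(i+1) :&: M] is not
   contained in [x_i], and suppose that [x_(i+1) \subset x_i <*> M] at each jump
   of [M]. If [M] is modular, then enlarging [M] strictly enlarges its set of
   jumps, so a chain of such subgroups has at most [n + 1] members.
   For a maximal chain [x] and the terms of a chief series this gives [c <= n].
   For a chief series [x] and a chain of modular subgroups it gives
   [modl G <= c], because a modular subgroup either contains a given minimal
   normal subgroup or meets it trivially; as normal subgroups are modular,
   [modl G = c].
   If [n = c], each chief factor [N' / N] has exactly one jump [i], for which
   [x_i :&: N' \subset N] and [N' \subset x_(i+1) * N]. Then [x_i] acts
   irreducibly on [N' / N], and coprime action shows, descending from the top,
   that [G / N] is solvable.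
   Conversely, a solvable [G] has a maximal subgroup [M] with ['F(G) * M = G];
   as ['F(G)] centralises chief factors, intersecting a chief series of [G] with
   [M] gives a shorter chief series of [M], and by induction [G] has a maximal
   chain of length at most [c]. *)

Set Implicit Arguments.
Unset Strict Implicit.
Unset Printing Implicit Defensive.

Local Open Scope group_scope.

(** * Modular subgroups *)

Section Modular.

Variable gT : finGroupType.
Implicit Types G H K L M N X Y : {group gT}.

(** Only one inclusion of each modular law is kept; the opposite one holds in every lattice. *)
Lemma modular_subgroupP G M :
  reflect [/\ M \subset G,
     forall X Y, X \subset Y -> Y \subset G ->
       (X <*> M) :&: Y \subset X <*> (M :&: Y)
   & forall X N, X \subset G -> N \subset G -> M \subset N ->
       (M <*> X) :&: N \subset M <*> (X :&: N)]
  (modular_subgroup G M).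
Proof.
apply: (iffP and3P) => [[sMG modl modr] | [sMG modl modr]].
  split=> [|X Y sXY sYG|X N sXG sNG sMN]; first by rewrite inE in sMG.
    have sXG := subset_trans sXY sYG.
    have sgX: X \in subgroups G by rewrite inE.
    have sgY: Y \in subgroups G by rewrite inE.
    have/forall_inP/(_ Y sgY) := forall_inP modl X sgX.
    by rewrite sXY => /eqP->.
  have sgX: X \in subgroups G by rewrite inE.
  have sgN: N \in subgroups G by rewrite inE.
  have/forall_inP/(_ N sgN) := forall_inP modr X sgX.
  by rewrite sMN => /eqP->.
split; first by rewrite inE.
  apply/forall_inP=> X _; apply/forall_inP=> Y; rewrite inE => sYG.
  apply/implyP=> sXY; rewrite eqEsubset modl // andbT.
  by rewrite subsetI genS ?setUS ?subsetIl //= join_subG sXY subsetIr.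
apply/forall_inP=> X; rewrite inE => sXG; apply/forall_inP=> N.
rewrite inE => sNG; apply/implyP=> sMN; rewrite eqEsubset modr // andbT.
by rewrite subsetI genS ?setUS ?subsetIl //= join_subG sMN subsetIr.
Qed.

Lemma modular_sub G M : modular_subgroup G M -> M \subset G.
Proof. by case/modular_subgroupP. Qed.

(** A join with a normal subgroup is a product, so both laws are instances of Dedekind's law. *)
Lemma normal_modular G N : N <| G -> modular_subgroup G N.
Proof.
case/andP=> sNG nNG; apply/modular_subgroupP.
split=> // [X Y sXY sYG|X H sXG sHG sNH].
  rewrite (norm_joinEl (subset_trans (subset_trans sXY sYG) nNG)).
  by rewrite -group_modl // mulG_subG joing_subl joing_subr.
rewrite (norm_joinEr (subset_trans sXG nNG)) -group_modl //.
by rewrite mulG_subG joing_subl joing_subr.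
Qed.

Lemma modularJ G M x : x \in 'N(G) ->
  modular_subgroup G M -> modular_subgroup G (M :^ x).
Proof.
move=> nGx /modular_subgroupP[sMG modl modr].
have sGJ H : (H :^ x^-1 \subset G) = (H \subset G).
  by rewrite -{1}(normP (groupVr nGx)) conjSg.
apply/modular_subgroupP; split=> [|X Y sXY sYG|X N sXG sNG].
- by rewrite -(normP nGx) conjSg.
- rewrite -(conjSg _ _ x^-1) conjIg !conjYg conjIg !conjsgK.
  by have:= modl (X :^ x^-1)%G (Y :^ x^-1)%G; rewrite /= conjSg sGJ; apply.
rewrite -{1}(conjsgKV x N) conjSg => sMN.
rewrite -(conjSg _ _ x^-1) conjIg !conjYg conjIg !conjsgK.
by apply: (modr (X :^ x^-1)%G (N :^ x^-1)%G); rewrite //= sGJ.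
Qed.

(** The first law restricts directly. For the second, [M] itself may fail to lie in [N], so the law
    of [G] is applied to [M <*> N]; the first law gives [(M <*> N) :&: H = N], and once more removes
    the part of [M] outside [H]. *)
Lemma modularS G H M : H \subset G ->
  modular_subgroup G M -> modular_subgroup H (M :&: H).
Proof.
move=> sHG /modular_subgroupP[sMG modl modr].
apply/modular_subgroupP; split=> [|X Y sXY sYH|X N sXH sNH sMN].
- exact: subsetIr.
- rewrite /= -setIA (setIidPr sYH).
  apply: subset_trans (modl X Y sXY (subset_trans sYH sHG)).
  by rewrite setSI // genS ?setUS ?subsetIl.
have sXG := subset_trans sXH sHG; have sNG := subset_trans sNH sHG.
have sMNG : M <*> N \subset G by rewrite join_subG sMG.
have defN : (M <*> N) :&: H \subset N.
  rewrite joingC; apply: subset_trans (modl N H sNH sHG) _.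
  by rewrite join_subG subxx.
pose U := (X :&: (M <*> N))%G.
have sUN : U \subset N.
  by apply: subset_trans defN; rewrite subsetI subsetIr subIset ?sXH.
have sUX : U \subset X :&: N by rewrite subsetI subsetIl.
have stepN : (M <*> X) :&: N \subset (U <*> M) :&: H.
  rewrite subsetI (subset_trans (subsetIr _ _) sNH) andbT (joingC U M).
  apply: subset_trans (setIS _ (joing_subr M N)) _.
  exact: modr X (M <*> N)%G sXG sMNG (joing_subl _ _).
have sUH : U \subset H := subset_trans sUN sNH.
have sMHX : ((M :&: H) <*> X) :&: N \subset (M <*> X) :&: N.
  by rewrite setSI // genS ?setSU ?subsetIl.
apply: subset_trans (subset_trans sMHX stepN) _.
apply: subset_trans (modl U H sUH sHG) _.
by rewrite joingC genS ?setUS.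
Qed.

(** Modularity lifts from the interval above [M]: replace [X] by [X <*> M], apply the law of [N]
    there, and let the laws of [M] take the added [M] away again. *)
Lemma modular_trans G M N : modular_subgroup G M ->
    M \subset N -> N \subset G ->
    (forall X Y, M \subset X -> X \subset Y -> Y \subset G ->
       (X <*> N) :&: Y \subset X <*> (N :&: Y)) ->
    (forall X K, M \subset X -> X \subset G -> K \subset G -> N \subset K ->
       (N <*> X) :&: K \subset N <*> (X :&: K)) ->
  modular_subgroup G N.
Proof.
case/modular_subgroupP=> sMG modl modr sMN sNG Nl Nr.
apply/modular_subgroupP; split=> // [X Y sXY sYG|X K sXG sKG sNK].
  (* [Z] is the target and lies in [Y]; the first law of [M] absorbs a further join with [M], since
     [M :&: Y] lies in [Z]. *)
  pose Z := (X <*> (N :&: Y))%G.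
  have sZY : Z \subset Y by rewrite join_subG sXY subsetIr.
  suff: (X <*> N) :&: Y \subset (Z <*> M) :&: Y.
    move/subset_trans; apply; apply: subset_trans (modl Z Y sZY sYG) _.
    rewrite join_subG subxx (subset_trans _ (joing_subr _ _)) //.
    by rewrite setSI.
  rewrite subsetI subsetIr andbT.
  have sYYM : Y \subset Y <*> M := joing_subl _ _.
  have := Nl (X <*> M)%G (Y <*> M)%G (joing_subr _ _).
  rewrite join_subG (subset_trans sXY sYYM) joing_subr /=.
  rewrite join_subG sYG sMG => /(_ isT isT) sub1.
  have sXN : (X <*> N) :&: Y \subset ((X <*> M) <*> N) :&: (Y <*> M).
    by rewrite setISS // genS ?setSU ?joing_subl.
  apply: subset_trans (subset_trans sXN sub1) _.
  rewrite join_subG; apply/andP; split.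
    by rewrite genS ?setSU ?joing_subl.
  rewrite setIC joingC.
  apply: subset_trans (modr Y N sYG sNG sMN) _.
  rewrite join_subG joing_subr /= setIC.
  by apply: subset_trans (joing_subl _ _); exact: joing_subr.
have := Nr (M <*> X)%G K (joing_subl _ _); rewrite join_subG sMG sXG.
move=> /(_ isT sKG sNK) sub1.
have sX : (N <*> X) :&: K \subset (N <*> (M <*> X)) :&: K.
  by rewrite setSI // genS ?setUS ?joing_subr.
apply: subset_trans (subset_trans sX sub1) _.
rewrite join_subG joing_subl.
apply: subset_trans (modr X K sXG sKG (subset_trans sMN sNK)) _.
by rewrite genS ?setSU.
Qed.

(** Above [M], joining with [M <*> N] amounts to joining with [N], so [modular_trans] reduces the
    laws to those of [N]. *)
Lemma modularY G M N :
  modular_subgroup G M -> modular_subgroup G N -> modular_subgroup G (M <*> N).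
Proof.
move=> modM /modular_subgroupP[sNG modl modr].
have sMG := modular_sub modM.
apply: (modular_trans modM); rewrite ?joing_subl ?join_subG ?sMG //.
  move=> X Y sMX sXY sYG; rewrite joingA (joing_idPl sMX).
  apply: subset_trans (modl X Y sXY sYG) _.
  by rewrite genS ?setUS ?setSI ?joing_subr.
move=> X K sMX sXG sKG; rewrite join_subG => /andP[sMK sNK].
have sMXK : M \subset X :&: K by rewrite subsetI sMX.
rewrite /= (joingC M) -!joingA (joing_idPr sMX) (joing_idPr sMXK).
exact: modr.
Qed.

End Modular.

(** Subgroups of [G / N] lift to overgroups of [N], and taking quotients commutes with joins and
    with meets against these lifts. *)
Lemma modular_quotient (gT : finGroupType) (G M N : {group gT}) : N <| G ->
  modular_subgroup G M -> modular_subgroup (G / N) (M / N).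
Proof.
move=> nsNG /modular_subgroupP[sMG modl modr].
have [sNG nNG] := andP nsNG; have nNM := subset_trans sMG nNG.
have pre (Xb : {group coset_of N}) : Xb \subset G / N ->
    exists2 X : {group gT}, Xb = (X / N)%G & N \subset X /\ X \subset G.
  by case/(inv_quotientS nsNG)=> X defX sNX sXG; exists X => //; apply: val_inj.
apply/modular_subgroupP; split=> [|Xb Yb sXYb sYbG|Xb Kb sXbG sKbG sMKb].
- exact: quotientS.
- have [Y defY [sNY sYG]] := pre _ sYbG.
  have [X defX [sNX sXG]] := pre _ (subset_trans sXYb sYbG).
  rewrite {}defX {}defY /= in sXYb *.
  have nNX := subset_trans sXG nNG.
  rewrite quotientSGK // in sXYb.
  have nNMY : M :&: Y \subset 'N(N) by rewrite subIset ?nNM.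
  rewrite -(quotientIG _ sNY) -!quotientY // -quotientIG //.
  exact/quotientS/modl.
have [K defK [sNK sKG]] := pre _ sKbG; have [X defX [sNX sXG]] := pre _ sXbG.
rewrite {}defX {}defK /= in sMKb *; rewrite quotientSGK // in sMKb.
have nNX := subset_trans sXG nNG.
have nNXK : X :&: K \subset 'N(N) by rewrite subIset ?nNX.
rewrite -(quotientIG _ sNK) -!quotientY // -quotientIG //.
exact/quotientS/modr.
Qed.

(** * Jumps of a chain *)

Lemma exists_switch (P : pred nat) n :
  P 0 -> ~~ P n -> exists i : 'I_n, P i && ~~ P i.+1.
Proof.
elim: n => [|n IHn] P0 nPn; first by rewrite P0 in nPn.
have [Pn | nPn'] := boolP (P n); first by exists ord_max; rewrite Pn.
by have [i Pi] := IHn P0 nPn'; exists (widen_ord (leqnSn n) i).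
Qed.

Section Jumps.

Variables (gT : finGroupType) (n : nat) (x : nat -> {group gT}).
Implicit Types G H K M N : {group gT}.

Definition jumps M := [set i : 'I_n | ~~ (x i.+1 :&: M \subset x i)].

Lemma jumpsS M N : M \subset N -> jumps M \subset jumps N.
Proof.
move=> sMN; apply/subsetP=> i; rewrite !inE; apply: contra.
exact: subset_trans (setIS _ sMN).
Qed.

Variable G : {group gT}.
Hypotheses (x0 : x 0 = 1%G) (xn : x n = G).
Hypothesis (sxG : forall i, i <= n -> x i \subset G).

Section Step.

Variables M N : {group gT}.
Hypotheses (modM : modular_subgroup G M) (ltMN : M \proper N).
Hypothesis sNG : N \subset G.
Hypothesis jumpM : forall i, i \in jumps M -> x i.+1 \subset x i <*> M.

Let modr i : i <= n -> (M <*> x i) :&: N \subset M <*> (x i :&: N).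
Proof.
move=> lei; have/modular_subgroupP[_ _ ->] := modM => //; first exact: sxG.
exact: proper_sub.
Qed.

(** Take [i] where [x i :&: N] lies in [M] but [x i.+1 :&: N] does not. If [M] jumped at [i], then
    [x i.+1] would lie in [M <*> x i], and the second law would put [x i.+1 :&: N] inside [M]. *)
Lemma jump_meet :
  exists2 i, i \in jumps N :\: jumps M & x i :&: N \subset M.
Proof.
have [||i /andP[sxiM nsxiM]] := @exists_switch (fun i => x i :&: N \subset M) n.
- by rewrite x0 subIset ?sub1G.
- by rewrite xn (setIidPr sNG); case/andP: ltMN.
exists i => //; rewrite in_setD andbC inE; apply/andP; split.
  apply: contra nsxiM => sxi; apply: subset_trans sxiM.
  by rewrite subsetI sxi subsetIr.
apply: contra nsxiM => /jumpM sxiM'; rewrite joingC in sxiM'.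
apply: subset_trans (setSI N sxiM') (subset_trans (modr (ltnW (ltn_ord i))) _).
by rewrite join_subG subxx.
Qed.

(** Dual search, for the step at which [x i <*> M] comes to contain [N]. When [N] has only one new
    jump, this index is that of [jump_meet] and both extra conclusions hold at once. *)
Lemma jump_join :
  exists2 i, i \in jumps N :\: jumps M & N \subset x i.+1 <*> M.
Proof.
pose P i := ~~ (N \subset x i <*> M).
have [||i /andP[nsNxi]] := @exists_switch P n.
- by rewrite /P x0 joing1G; case/andP: ltMN.
- by rewrite /P xn negbK (subset_trans sNG) ?joing_subl.
rewrite negbK => sNxi; exists i => //; rewrite in_setD andbC inE.
apply/andP; split.
  apply: contra nsNxi => sxi; rewrite -{1}(setIidPr sNxi) joingC.
  apply: subset_trans (modr (ltn_ord i)) _.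
  by rewrite joingC genS ?setSU.
apply: contra nsNxi => /jumpM sxiM; apply: subset_trans sNxi _.
by rewrite join_subG sxiM joing_subr.
Qed.

End Step.

(** The number of jumps is injective on [C] and takes values from 0 to [n]. *)
Lemma card_chain_jumps (C : {set {group gT}}) :
    subgroup_chain G C ->
    (forall M, M \in C -> modular_subgroup G M) ->
    (forall M i, M \in C -> i \in jumps M -> x i.+1 \subset x i <*> M) ->
  #|C| <= n.+1.
Proof.
case/andP=> sCG /forall_inP chC modC jumpC.
have ltn_jumps M N : M \in C -> N \in C -> M \proper N ->
    #|jumps M| < #|jumps N|.
  move=> CM CN ltMN; have sNG := modular_sub (modC N CN).
  have jM i := jumpC M i CM.
  have [i /setDP[jNi jMi] _] := jump_meet (modC M CM) ltMN sNG jM.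
  apply/proper_card/properP; split; first exact/jumpsS/proper_sub.
  by exists i.
have lt_jumps M : #|jumps M| < n.+1.
  by rewrite ltnS -[n in _ <= n]card_ord max_card.
rewrite -[n.+1]card_ord -(card_in_imset (f := fun M => Ordinal (lt_jumps M))).
  exact: max_card.
move=> M N CM CN /(congr1 val) /= eqj; apply/val_inj.
have/forall_inP/(_ N CN)/orP[sMN | sNM] := chC M CM.
  apply/eqP; apply: contraT => neMN; have := ltn_jumps M N CM CN.
  by rewrite properEneq neMN sMN eqj ltnn => /(_ isT).
apply/eqP; rewrite eq_sym; apply: contraT => neMN; have := ltn_jumps N M CN CM.
by rewrite properEneq neMN sNM eqj ltnn => /(_ isT).
Qed.

End Jumps.

(** * Maximal chains as series *)

Section MaximalSeries.

Variable gT : finGroupType.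
Implicit Types (G H K L : {group gT}) (s : seq {group gT}).

(** The initial trivial group is left out of [s], so that [size s] is the length of the chain. *)
Definition max_series s := path (fun H K => maximal H K) 1%G s.

Lemma max_chain_mem G (C : {set {group gT}}) L :
    max_subgroup_chain G C -> L \subset G ->
    (forall H, H \in C -> (H \subset L) || (L \subset H)) ->
  L \in C.
Proof.
case/maxsetP=> /andP[sCG /forall_inP chC] maxC sLG cmpL.
rewrite -(maxC (L |: C)) ?subsetUr ?setU11 //.
apply/andP; split; first by rewrite subUset sub1set inE sLG.
apply/forall_inP=> H /setU1P[-> | CH]; apply/forall_inP=> K /setU1P[-> | CK].
- by rewrite subxx.
- by rewrite orbC cmpL.
- exact: cmpL.
by have/forall_inP->:= chC H CH.
Qed.

Lemma max_chain_series G (C : {set {group gT}}) :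
    max_subgroup_chain G C ->
  exists s, [/\ max_series s, last 1%G s = G & #|C| = (size s).+1].
Proof.
move=> maxC; have/andP[sCG /forall_inP chC] := maxsetp maxC.
have sC H : H \in C -> H \subset G by move/(subsetP sCG); rewrite inE.
have C1 : 1%G \in C.
  by apply: max_chain_mem maxC (sub1G _) _ => H _; rewrite sub1G orbT.
have CG : G \in C by apply: max_chain_mem maxC (subxx _) _ => H /sC->.
(* Within a chain, comparing orders is the same as comparing by inclusion, and it is a total
   preorder on all groups, as sorting requires. *)
pose le H K := #|H| <= #|K|; pose t := sort le (enum C).
have le_tr : transitive le by move=> H K L; apply: leq_trans.
have le_tot : total le by move=> H K; apply: leq_total.
have mem_t H : (H \in t) = (H \in C) by rewrite mem_sort mem_enum.
have uniq_t : uniq t by rewrite sort_uniq enum_uniq.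
have size_t : size t = #|C| by rewrite size_sort -cardE.
have sorted_t : sorted le t by apply: sort_sorted.
clearbody t; have leC H K : H \in C -> K \in C -> le H K -> H \subset K.
  move=> CH CK leHK; have/forall_inP/(_ K CK)/orP[//|sKH] := chC H CH.
  by have/eqP->: K :==: H by rewrite eqEcard sKH.
have nth_t i : i < size t -> nth 1%G t i \in C.
  by rewrite -mem_t; apply: mem_nth.
have nthS i j : i <= j -> j < size t -> nth 1%G t i \subset nth 1%G t j.
  move=> leij ltj; have lti := leq_ltn_trans leij ltj.
  apply: leC; rewrite ?nth_t //.
  by apply: (sorted_leq_nth le_tr) => // H; rewrite /le.
have [i0 lti0 def1] : exists2 i, i < size t & nth 1%G t i = 1%G.
  by exists (index 1%G t); rewrite ?nth_index ?index_mem ?mem_t.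
have [i1 lti1 defG] : exists2 i, i < size t & nth 1%G t i = G.
  by exists (index G t); rewrite ?nth_index ?index_mem ?mem_t.
have t0 : nth 1%G t 0 = 1%G.
  by apply/val_inj/trivgP; have:= nthS 0 i0 (leq0n _) lti0; rewrite def1.
have tG : last 1%G t = G.
  have t_gt0 : 0 < size t by apply: leq_ltn_trans lti0.
  apply/val_inj/eqP; rewrite /= -nth_last eqEsubset sC ?nth_t ?prednK //=.
  by rewrite -{1}defG nthS ?prednK // -ltnS prednK.
(* A group between two consecutive terms is comparable with every member, hence belongs to [C] and
   occupies an index of [t]. *)
have max_t i : i.+1 < size t -> maximal (nth 1%G t i) (nth 1%G t i.+1).
  move=> lti; apply/maxgroupP; split=> [|L ltL sL].
    rewrite properEneq nthS // andbT; apply/eqP=> /val_inj/eqP.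
    by rewrite nth_uniq ?(ltnW lti) // ltn_eqF.
  have CL : L \in C.
    apply: max_chain_mem maxC _ _ => [|H].
      by apply: subset_trans (proper_sub ltL) (sC _ (nth_t _ lti)).
    rewrite -mem_t => tH; rewrite -(nth_index 1%G tH).
    have [leji | ltij] := leqP (index H t) i.
      by rewrite (subset_trans (nthS _ _ leji (ltnW lti))).
    by rewrite orbC (subset_trans (proper_sub ltL)) ?nthS ?index_mem.
  rewrite -mem_t in CL; move: ltL sL; rewrite -(nth_index 1%G CL).
  have [leji _ sL | ltij /andP[_ /negP[]]] := leqP (index L t) i.
    by apply/eqP; rewrite eqEsubset sL nthS // ltnW.
  by rewrite nthS ?index_mem.
have [s def_t] : exists s, t = 1%G :: s.
  by case: (t) t0 lti0 => //= H s -> _; exists s.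
exists s; rewrite -size_t -tG def_t; split=> //.
by apply/(pathP 1%G) => i lti; have:= max_t i; rewrite def_t /= ltnS; apply.
Qed.

Section ProperSeries.

Variable s : seq {group gT}.
Hypothesis lt_s : path (fun H K => H \proper K) 1%G s.
Let x := nth 1%G (1%G :: s).

Lemma proper_series_lt i : i < size s -> x i \proper x i.+1.
Proof. by move=> lti; have/(pathP 1%G)/(_ i lti) := lt_s. Qed.

Lemma proper_series_sub i j : i <= j -> j <= size s -> x i \subset x j.
Proof.
move=> leij; elim: j leij => [|j IHj]; first by rewrite leqn0 => /eqP->.
rewrite leq_eqVlt => /predU1P[->|leij lejs] //.
exact: subset_trans (IHj leij (ltnW lejs)) (proper_sub (proper_series_lt lejs)).
Qed.

Lemma mem_proper_series H :
  H \in [set K in 1%G :: s] -> exists2 i, i <= size s & H = x i.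
Proof. by rewrite inE => /(nthP 1%G)[i lti <-]; exists i. Qed.

Lemma proper_series_chain : subgroup_chain (last 1%G s) [set H in 1%G :: s].
Proof.
apply/andP; split.
  apply/subsetP=> H /mem_proper_series[i lei ->].
  have eq_last : x (size s) = last 1%G s by rewrite /x nth_last.
  rewrite inE -eq_last.
  exact: proper_series_sub.
apply/forall_inP=> _ /mem_proper_series[i lei ->].
apply/forall_inP=> _ /mem_proper_series[j lej ->].
have [leij|ltji] := leqP i j; first by rewrite proper_series_sub.
by rewrite orbC proper_series_sub // ltnW.
Qed.

Lemma card_proper_series : #|[set H in 1%G :: s]| = (size s).+1.
Proof.
have uniq_s : uniq (1%G :: s).
  apply/(uniqP 1%G) => i j; rewrite !inE /= !ltnS => lei lej.
  rewrite -/(x i) -/(x j).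
  wlog ltij : i j lei lej / i < j.
    move=> IH eqx; have [ltij|ltji|//] := ltngtP i j; first exact: IH.
    exact/esym/IH.
  move=> eqx; have := proper_series_lt (leq_trans ltij lej); rewrite properE.
  by rewrite eqx (@proper_series_sub i.+1 j) ?andbF.
by rewrite cardsE (card_uniqP uniq_s).
Qed.

End ProperSeries.

Lemma series_max_chain s :
    max_series s ->
  exists2 C, max_subgroup_chain (last 1%G s) C & #|C| = (size s).+1.
Proof.
set G := last _ s => max_s; pose x := nth 1%G (1%G :: s).
have maxx i : i < size s -> maximal (x i) (x i.+1).
  by move=> lti; have/(pathP 1%G)/(_ i lti) := max_s.
have lt_s : path (fun H K => H \proper K) 1%G s.
  by apply: sub_path max_s => H K /maxgroupp.
have xG : x (size s) = G by rewrite /x nth_last.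
exists [set H in 1%G :: s]; last exact: card_proper_series.
have Cx i : i <= size s -> x i \in [set H in 1%G :: s].
  by move=> lei; rewrite inE mem_nth.
apply/maxsetP; split=> [|D /andP[sDG /forall_inP chD] sCD].
  exact: proper_series_chain.
apply/eqP; rewrite eqEsubset sCD andbT; apply/subsetP=> H DH.
have := subsetP sDG H DH; rewrite inE => sHG.
have [sGH | nsGH] := boolP (G \subset H).
  have <- : G = H by apply/val_inj/eqP; rewrite eqEsubset sGH.
  by rewrite -xG Cx.
(* Comparability squeezes [H] between [x i] and [x i.+1], properly below the latter, so [H] is [x i]
   by maximality. *)
have [||i /andP[sxH nsxH]] := @exists_switch (fun i => x i \subset H) (size s).
- by rewrite sub1G.
- by rewrite xG.
have Dx : x i.+1 \in D by rewrite (subsetP sCD) ?Cx.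
have/forall_inP/(_ _ Dx) := chD H DH; rewrite (negPf nsxH) orbF => sHx.
have/maxgroupP[_ maxi] := maxx i (ltn_ord i).
have eqHx : H = x i.
  apply/val_inj/maxi => //; rewrite properEneq sHx andbT.
  by apply: contraNneq nsxH => ->.
by rewrite eqHx Cx // ltnW.
Qed.

End MaximalSeries.

(** * Solvable groups acting irreducibly *)

(* If [H] acts nontrivially, pick [A] with [A / 'C_H(N)] a minimal normal
   p-subgroup of [H / 'C_H(N)] and [P] Sylow in [A]. Then ['C_N(P) = 1], so [p]
   does not divide [#|N|] and the [P]-invariant Sylow q-subgroup of [N] is
   unique, hence [H]-invariant, hence all of [N]. *)
Lemma irreducible_sol (gT : finGroupType) (H N : {group gT}) :
    solvable H -> H \subset 'N(N) ->
    (forall U : {group gT}, U \subset N -> H \subset 'N(U) ->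
       U :=: 1 \/ U :=: N) ->
  solvable N.
Proof.
move=> solH nNH irrN.
have [-> | ntN] := eqsVneq N 1; first exact: solvable1.
have [cNH | ncNH] := boolP (H \subset 'C(N)).
  have [x Nx ntx] := trivgPn _ ntN.
  have nxH : H \subset 'N(<[x]>).
    by rewrite cents_norm // (subset_trans cNH) // centS ?cycle_subG.
  have [|/eqP|<-] := irrN <[x]>%G _ nxH; rewrite ?cycle_subG //.
    by rewrite cycle_eq1 (negPf ntx).
  by rewrite abelian_sol ?cycle_abelian.
pose C := 'C_H(N)%G.
have nsCH : C <| H by rewrite /normal subsetIl normsI ?normG ?norms_cent.
have ntHC : H / C != 1.
  by rewrite -subG1 quotient_sub1 ?normal_norm // subsetI subxx.
have [Ab [sAbH nsAb ntAb /is_abelemP[p p_pr abelAb]]] :=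
  solvable_norm_abelem (quotient_sol C solH) (normal_refl _) ntHC.
have [A defA sCA nsAH] := inv_quotientN nsCH nsAb.
have [sAH nAH] := andP nsAH; have nCA := subset_trans sAH (normal_norm nsCH).
have [P sylP] := Sylow_exists p A; have [sPA pP _] := and3P sylP.
have cCN : C \subset 'C(N) := subsetIr _ _.
have defAP : A \subset C * P.
  rewrite -quotientSK //.
  have sylPC := quotient_pHall (subset_trans sPA nCA) sylP.
  have pA : p.-group (A / C) by rewrite -defA; apply: abelem_pgroup abelAb.
  by rewrite (pHall_id sylPC pA).
have cAN1 : 'C_N(A) = 1.
  have [||//|cAN] := irrN 'C_N(A)%G; rewrite ?subsetIl //.
    by rewrite normsI ?norms_cent.
  case/negP: ntAb; rewrite defA -subG1 quotient_sub1 // subsetI sAH.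
  by rewrite centsC -{1}cAN subsetIr.
have cPN1 : 'C_N(P) = 1.
  apply/trivgP; rewrite -cAN1 subsetI subsetIl /= centsC.
  rewrite (subset_trans defAP) // mul_subG //.
    by rewrite (subset_trans cCN) // centS ?subsetIl.
  by rewrite centsC subsetIr.
have nNP : P \subset 'N(N) := subset_trans sPA (subset_trans sAH nNH).
have coNP : coprime #|N| #|P|.
  rewrite coprime_sym (pnat_coprime pP) // p'natE //.
  have actP : [acts P, on N | 'J] by rewrite astabsJ.
  have := pgroup_fix_mod pP actP; rewrite afixJ cPN1 cards1 => eqN.
  by rewrite /dvdn eqN modn_small ?prime_gt1.
have ltN1 : 1 < #|N| by rewrite cardG_gt1.
have q_pr := pdiv_prime ltN1; set q := pdiv _ in q_pr.
have solP : solvable P := pgroup_sol pP.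
have [Q sylQ nQP] := sol_coprime_Sylow_exists q solP nNP coNP.
have [sQN qQ _] := and3P sylQ.
have nQA : A \subset 'N(Q).
  rewrite (subset_trans defAP) // mul_subG //.
  by rewrite cents_norm // (subset_trans cCN) ?centS.
have nQH : H \subset 'N(Q).
  apply/subsetP=> h Hh; apply/normP; apply/eqP.
  have trQ := atransP2 (sol_coprime_Sylow_trans q solP nNP coNP).
  have [||c] := trQ Q (Q :^ h)%G; rewrite ?inE ?sylQ ?nQP //.
    rewrite pHallJnorm ?(subsetP nNH) // sylQ (subset_trans sPA) //.
    by rewrite -(normP (subsetP nAH h Hh)) normJ conjSg.
  rewrite -in_setI cPN1 => /set1P-> /(congr1 val) /= ->; by rewrite conjsg1.
have [|eqQN] := irrN Q sQN nQH.
  move=> Q1; have := card_Hall sylQ; rewrite Q1 cards1 => /esym/eqP.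
  by rewrite p_part_eq1 mem_primes q_pr cardG_gt0 pdiv_dvd.
by rewrite -eqQN (pgroup_sol qQ).
Qed.

(** * Chief length and maximal chains *)

Section LowerBound.

Variable gT : finGroupType.
Implicit Types G H K L M N : {group gT}.

(** Since [H :&: N] lies in [M], the action of [H] on [N / M] factors through a subgroup of the
    solvable group [G / N]. It is irreducible: for an invariant [U] between [M] and [N], maximality
    makes [(U <*> H) :&: K] equal to [K], which forces [U = N], or to [H], which forces [U = M].
    Then [irreducible_sol] applies. *)
Lemma factor_sol G M N H K :
    M <| G -> N <| G -> M \subset N -> maximal H K -> K \subset G ->
    H :&: N \subset M -> N \subset K <*> M -> solvable (G / N) ->
  solvable (G / M).
Proof.
move=> nsMG nsNG sMN /maxgroupP[ltHK maxH] sKG sHNM sNKM solGN.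
have sHK := proper_sub ltHK; have sHG := subset_trans sHK sKG.
have [[sMG nMG] [sNG nNG]] := (andP nsMG, andP nsNG).
have nMH := subset_trans sHG nMG; have nMN := subset_trans sNG nMG.
have nMK := subset_trans sKG nMG.
have solGMN : solvable (G / M / (N / M)).
  by rewrite (isog_sol (third_isog sMN nsMG nsNG)).
have nsNMGM : N / M <| G / M by apply: quotient_normal.
rewrite (series_sol nsNMGM) solGMN andbT.
have nNM_HM : H / M \subset 'N(N / M).
  exact: subset_trans (quotientS M sHG) (normal_norm nsNMGM).
apply: irreducible_sol (nNM_HM) _.
  have tiNH : N / M :&: H / M = 1.
    by rewrite -quotientGI //; apply: quotientS1; rewrite /= setIC.
  rewrite (isog_sol (quotient_isog nNM_HM tiNH)).
  exact: solvableS (quotientS _ (quotientS _ sHG)) solGMN.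
move=> Ub sUbN nUbH.
have nsMN : M <| N by rewrite /normal sMN.
have [U defU sMU sUN] := inv_quotientS nsMN sUbN.
have nMU := subset_trans sUN nMN.
have nUH : H \subset 'N(U).
  have nsMU : M <| U by rewrite /normal sMU.
  by rewrite -(quotientGK nsMU) -defU norm_quotient_pre.
pose Z := ((U <*> H) :&: K)%G.
have sHZ : H \subset Z by rewrite subsetI joing_subr.
have defUH := norm_joinEr nUH.
have [eqZ | ltZ] := eqVproper (subsetIr (U <*> H) K).
  right; rewrite defU; suff -> : U = N by [].
  apply/val_inj/eqP; rewrite /= eqEsubset sUN /=.
  have sKUH : K \subset U <*> H by rewrite -eqZ subsetIl.
  have sNUH : N \subset U * H.
    rewrite -defUH (subset_trans sNKM) // join_subG sKUH.
    exact: subset_trans sMU (joing_subl _ _).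
  rewrite -(setIidPr sNUH) -group_modl // mulG_subG subxx /=.
  exact: subset_trans sHNM sMU.
left; rewrite defU quotientS1 //.
have eqZH : Z :=: H by apply: maxH.
have sUMK : U \subset M * K.
  by rewrite -norm_joinEr // joingC (subset_trans sUN).
rewrite -(setIidPr sUMK) -group_modl // mulG_subG subxx /=.
apply: subset_trans sHNM; rewrite subsetI [_ \subset N]subIset ?sUN ?orbT //.
by rewrite -eqZH /= subsetI subsetIl subIset // joing_subl orbT.
Qed.

Section Series.

Variables (s c : seq {group gT}).
Hypotheses (max_s : max_series s) (chief_c : (last 1%G s).-chief.-series 1%G c).
Hypothesis last_c : last 1%G c = last 1%G s.
Let G := last 1%G s.
Let n := size s.
Let k := size c.
Let x := nth 1%G (1%G :: s).
Let y := nth 1%G (1%G :: c).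

Let lt_s : path (fun H K => H \proper K) 1%G s.
Proof. by apply: sub_path max_s => H K /maxgroupp. Qed.

Let lt_c : path (fun H K => H \proper K) 1%G c.
Proof. by apply: sub_path chief_c => H K /andP[/maxgroupp/andP[]]. Qed.

Let xn : x n = G.
Proof. by rewrite /x /n nth_last. Qed.

Let yk : y k = G.
Proof. by rewrite /y /k nth_last. Qed.

Let x_max i : i < n -> maximal (x i) (x i.+1).
Proof. by move=> lti; have/(pathP 1%G)/(_ i lti) := max_s. Qed.

Let sxG i : i <= n -> x i \subset G.
Proof. by move=> lei; rewrite -xn proper_series_sub. Qed.

Let y_normal i : i <= k -> y i <| G.
Proof.
case: i => [|i lti]; first by rewrite /normal sub1G norms1.
by have/(pathP 1%G)/(_ i lti)/andP[] := chief_c.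
Qed.

(** At a jump, [x j <*> (x j.+1 :&: y i)] is strictly above [x j], hence is all of [x j.+1] by
    maximality. *)
Let y_jump i j : j \in jumps n x (y i) -> x j.+1 \subset x j <*> y i.
Proof.
rewrite inE => nsx; have ltj := ltn_ord j.
have/maxgroupP[ltx maxx] := x_max ltj; have sx := proper_sub ltx.
have sub : x j <*> (x j.+1 :&: y i) \subset x j.+1.
  by rewrite join_subG sx subsetIl.
have [eqx | ltxx] := eqVproper sub.
  by rewrite -{1}eqx genS ?setUS ?subsetIr.
case/negP: nsx; rewrite -(maxx (x j <*> (x j.+1 :&: y i))%G) ?joing_subr //=.
exact: joing_subl.
Qed.

Let y_modular i : i <= k -> modular_subgroup G (y i).
Proof. by move/y_normal; apply: normal_modular. Qed.

Let y_lt i : i < k -> y i \proper y i.+1.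
Proof. exact: proper_series_lt. Qed.

Let jumps_lt i : i < k -> #|jumps n x (y i)| < #|jumps n x (y i.+1)|.
Proof.
move=> lti; have sNG := modular_sub (y_modular lti).
have [j /setDP[jNi jMi] _] := jump_meet (erefl _) xn sxG
  (y_modular (ltnW lti)) (y_lt lti) sNG (@y_jump i).
apply/proper_card/properP; split; last by exists j.
exact/jumpsS/proper_sub/y_lt.
Qed.

Let jumps_ge i : i <= k -> i <= #|jumps n x (y i)|.
Proof.
elim: i => // i IHi lti.
exact: leq_ltn_trans (IHi (ltnW lti)) (jumps_lt lti).
Qed.

(** Counting down from the top complements [jumps_ge]: if [n <= k], then [y j] has exactly [j]
    jumps. *)
Let jumps_le i : i <= k -> #|jumps n x (y (k - i))| + i <= n.
Proof.
elim: i => [_ | i IHi lti].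
  by rewrite addn0 -[n in _ <= n]card_ord max_card.
have ltk : k - i.+1 < k by rewrite subnSK ?leq_subr.
have := IHi (ltnW lti); apply: leq_trans; rewrite addnS -addSn leq_add2r.
by have := jumps_lt ltk; rewrite subnSK.
Qed.

Lemma chief_series_le : size c <= size s.
Proof. by have := jumps_le (leqnn k); apply: leq_trans; rewrite leq_addl. Qed.

Lemma chief_series_eq_sol : size s <= size c -> solvable G.
Proof.
move=> lenk.
suff sol i : i <= k -> solvable (G / y (k - i)).
  have := sol k (leqnn k); rewrite subnn /= => solG1.
  by rewrite (isog_sol (quotient1_isog G)).
elim: i => [_ | i IHi lti].
  by rewrite subn0 yk trivg_quotient solvable1.
have := IHi (ltnW lti); rewrite -(subnSK lti).
have ltj : k - i.+1 < k by rewrite subnSK ?leq_subr.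
have ley : #|jumps n x (y (k - i.+1).+1)| <= (k - i.+1).+1.
  rewrite subnSK // -(leq_add2r i) subnK ?(ltnW lti) //.
  exact: leq_trans (jumps_le (ltnW lti)) lenk.
move: (k - i.+1)%N ltj ley => j ltj ley solGN.
have sNG := modular_sub (y_modular ltj).
have [i1 jump1 sHNM] := jump_meet (erefl _) xn sxG
  (y_modular (ltnW ltj)) (y_lt ltj) sNG (@y_jump j).
have [i2 jump2 sNKM] := jump_join (erefl _) xn sxG
  (y_modular (ltnW ltj)) (y_lt ltj) sNG (@y_jump j).
(* [y j.+1] has at most [j + 1] jumps and [y j] at least [j], leaving room for a single new one. *)
have eqi : i1 = i2.
  apply/eqP; apply: contraT => nei.
  have sub2 : [set i1; i2] \subset jumps n x (y j.+1) :\: jumps n x (y j).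
    by apply/subsetP=> i3 /set2P[]->.
  have := subset_leq_card sub2; rewrite cards2 nei cardsD.
  rewrite (setIidPr (jumpsS _ _ (proper_sub (y_lt ltj)))).
  rewrite leqNgt => /negP[]; rewrite ltn_subLR.
    by apply: leq_ltn_trans ley _; rewrite addn2 !ltnS jumps_ge // ltnW.
  exact/ltnW/jumps_lt.
rewrite -{}eqi in sNKM.
apply: factor_sol (x_max (ltn_ord i1)) _ sHNM sNKM solGN => //.
- exact/y_normal/ltnW.
- exact: y_normal.
- exact/proper_sub/y_lt.
exact/sxG.
Qed.

End Series.

End LowerBound.

(** * Maximal modular subgroups *)

Section Burnside.

Variables (gT : finGroupType) (p : nat) (G P : {group gT}).
Hypotheses (sylP : p.-Sylow(G) P) (cNP : 'N_G(P) \subset 'C(P)).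

Let sPG : P \subset G. Proof. exact: pHall_sub sylP. Qed.

Let abP : abelian P.
Proof. by apply: subset_trans cNP; rewrite subsetI sPG normG. Qed.

(** As [P] is abelian, [P] and [P :^ g] are both Sylow in the centraliser of [u ^ g], so some [c]
    there conjugates one to the other. Then [g * c] normalises, hence centralises, [P]. *)
Lemma central_Sylow_fusion u g : u \in P -> g \in G -> u ^ g \in P -> u ^ g = u.
Proof.
move=> Pu Gg Pug; pose C := 'C_G[u ^ g]%G.
have sPC : P \subset C.
  by rewrite subsetI sPG sub_cent1 (subsetP abP).
have sPgC : P :^ g \subset C.
  by rewrite subsetI conj_subG //= cent1J conjSg sub_cent1 (subsetP abP).
have sylPC := pHall_subl sPC (subsetIl _ _) sylP.
have sylPgC : p.-Sylow(C) (P :^ g)%G.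
  by rewrite (pHall_subl sPgC (subsetIl _ _)) // pHallJ.
have [c /setIP[Gc cugc] /= defP] := Sylow_trans sylPgC sylPC.
have cPgc : g * c \in 'C(P).
  by rewrite (subsetP cNP) // inE groupM //= inE conjsgM -defP.
have fix_c : (u ^ g) ^ c = u ^ g by rewrite conjgE -(cent1P cugc) mulKg.
by rewrite -fix_c -conjgM conjgE -(centP cPgc) // mulKg.
Qed.

(** Absence of fusion makes the transfer to [P] raise elements of [P] to the power [#|G : P|], which
    is prime to [#|P|]. Its kernel is thus not [G], so it is trivial and [G] embeds in [P]. *)
Lemma Burnside_simple_abelian : simple G -> P :!=: 1 -> abelian G.
Proof.
case/simpleP=> _ simG /trivgPn[x Px ntx].
have Gx := subsetP sPG x Px.
have memA u : u \in P -> u \in idm P @* P by rewrite morphim_idm.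
have abA : abelian (idm P @* P) by rewrite morphim_idm.
pose f := transfer_morphism G abA.
have trX := transversalP (rcosets_cycle_partition sPG Gx).
have fx : f x = FiniteModule.fmod abA (x ^+ #|G : P|).
  rewrite -(sum_index_rcosets_cycle sPG Gx trX) /f /=.
  rewrite (transfer_cycle_expansion sPG abA Gx trX) FiniteModule.fmodX ?memA //.
  rewrite -ssralg.GRing.sumrMnr; apply: eq_bigr => y Xy.
  have Gy : y \in G by rewrite (subsetP (transversal_sub trX)).
  have Pxy : (x ^+ #|<[x]> : P :* y|) ^ y^-1 \in P.
    rewrite conjgE invgK mulgA -mem_rcoset; exact: mulg_exp_card_rcosets.
  have eqx := central_Sylow_fusion (groupX _ Px) (groupVr Gy) Pxy.
  by rewrite /= /restrm /= eqx -FiniteModule.fmodX ?memA.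
have : 'ker f <| G by apply: ker_normal.
case/simG=> [kerf | kerf].
  have injf : 'injm f by rewrite kerf.
  have := injm_abelian injf (subxx G); rewrite finalg.FinRing.zmod_abelian.
  by move<-.
have : x \in 'ker f by rewrite kerf.
move/mker; rewrite fx => fx0; case/eqP: ntx.
have coPi : coprime #|P| #|G : P|.
  have [_ pP p'i] := and3P sylP; exact: pnat_coprime pP p'i.
rewrite -(expgK coPi Px) /=.
have -> : x ^+ #|G : P| = 1; last by rewrite expg1n.
rewrite -(FiniteModule.fmodK abA (x := x ^+ _)) ?memA ?groupX //.
by rewrite fx0.
Qed.

End Burnside.

Section MaximalModular.

Variable gT : finGroupType.
Implicit Types G H K L M N : {group gT}.

(** If [Z] lies between [H :&: M] and [H] but not in [M], then [Z <*> M = G], and the first law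
    yields [H = Z <*> (M :&: H) = Z]. *)
Lemma modular_maximal_meet G H M :
    maximal M G -> modular_subgroup G M -> H \subset G -> ~~ (H \subset M) ->
  maximal (H :&: M) H.
Proof.
case/maxgroupP=> ltMG maxM /modular_subgroupP[sMG modl _] sHG nsHM.
apply/maxgroupP; split=> [|Z /andP[sZH nsHZ] sHMZ].
  by rewrite properE subsetIl subsetI subxx.
apply/eqP; rewrite eqEsubset sHMZ subsetI sZH !andbT /=.
apply: contraR nsHZ => nsZM; have sZG := subset_trans sZH sHG.
have sZMG : Z <*> M \subset G by rewrite join_subG sZG.
have [eqZM | ltZM] := eqVproper sZMG.
  have := modl Z H sZH sHG; rewrite eqZM (setIidPr sHG) => /subset_trans->//.
  by rewrite join_subG subxx setIC.
case/negP: nsZM; rewrite -(maxM (Z <*> M)%G) ?joing_subr //.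
exact: joing_subl.
Qed.

(* Every [H \subset G] lies in, or meets maximally, each conjugate of [M].
   Applied to a Sylow subgroup [P] for the smallest prime, this makes [P]
   abelian; applied to [W <*> Q] with [Q \subset 'N(P)] a p'-group and
   [W \subset [~: P, Q]] irreducible under [Q], it puts [W] in the core of
   [M]. So ['N_G(P)] centralises [P], contradicting Burnside's theorem. *)
Lemma simple_maximal_modular_sol G M :
  simple G -> maximal M G -> modular_subgroup G M -> solvable G.
Proof.
move=> simG maxM modM; have [ntG normG1] := simpleP _ simG.
have ltMG := maxgroupp maxM.
have coreM (X : {set gT}) :
    (forall g, g \in G -> X \subset M :^ g) -> X \subset [1 gT].
  move=> sXMg; have sX : X \subset gcore M G.
    by rewrite /gcore; apply/bigcapsP=> g; apply: sXMg.
  have nsM : gcore M G <| G.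
    by rewrite gcore_normal // proper_sub.
  have [core1 | coreG] := normG1 [group of gcore M G] nsM.
    by rewrite -core1.
  by case/andP: ltMG => _ /negP[]; rewrite -{1}coreG gcore_sub.
have maxMg H g : g \in G -> H \subset G -> ~~ (H \subset M :^ g) ->
    maximal (H :&: M :^ g) H.
  move=> Gg; have nGg : g \in 'N(G) by rewrite (subsetP (normG G)).
  apply: (@modular_maximal_meet G H (M :^ g)%G); last exact: modularJ.
  by rewrite -(normP nGg) maximalJ.
apply: contraT => nsolG.
pose p := pdiv #|G|; have ltG1 : 1 < #|G| by rewrite cardG_gt1.
have p_pr : prime p := pdiv_prime ltG1.
have [P sylP] := Sylow_exists p G; have [sPG pP _] := and3P sylP.
have ntP : P :!=: 1.
  rewrite -cardG_gt1 (card_Hall sylP) p_part_gt1 mem_primes p_pr cardG_gt0.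
  exact: pdiv_dvd.
have abP : abelian P.
  (* A maximal subgroup of a p-group is normal of prime index, so the derived subgroup of [P] lies
     in every conjugate of [M]. *)
  apply/derG1P/trivgP/coreM=> g Gg.
  have [sPM | nsPM] := boolP (P \subset M :^ g).
    exact: subset_trans (der_sub 1 P) sPM.
  have maxP := maxMg P g Gg sPG nsPM.
  apply: subset_trans (subsetIr P _); apply: der1_min.
    exact: normal_norm (p_maximal_normal pP maxP).
  rewrite cyclic_abelian // prime_cyclic // card_quotient.
    by rewrite (p_maximal_index pP maxP).
  exact: normal_norm (p_maximal_normal pP maxP).
pose H := 'N_G(P)%G.
have ncHP : ~~ (H \subset 'C(P)).
  apply: contra nsolG => cHP.
  exact: abelian_sol (Burnside_simple_abelian sylP cHP simG ntP).
have /existsP[Q /andP[sylQ ncQP]] :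
    [exists Q : {group gT}, Sylow H Q && ~~ (Q \subset 'C(P))].
  apply: contraR ncHP; rewrite negb_exists => /forallP cQP.
  rewrite -(Sylow_gen H) gen_subG; apply/bigcupsP=> Q sylQ.
  by have := cQP Q; rewrite sylQ negbK.
have ntQ : Q :!=: 1 by apply: contraNneq ncQP => ->; apply: sub1G.
have [q q_pr /and3P[sQH qQ _]] := SylowP _ _ sylQ.
have [sQG nPQ] := subsetIP sQH.
have q_dv_Q : q %| #|Q|.
  by have [_ ->] := pgroup_pdiv qQ ntQ.
have neqp : q != p.
  apply: contraNneq ncQP => eqp; rewrite eqp in qQ.
  have nsPH : P <| H by rewrite normalSG.
  have sylPH := pHall_subl (normal_sub nsPH) (subsetIl G 'N(P)) sylP.
  apply: subset_trans abP; rewrite (sub_normal_Hall sylPH nsPH sQH).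
  exact: qQ.
have ltpq : p < q.
  rewrite ltn_neqAle eq_sym neqp pdiv_min_dvd ?prime_gt1 //.
  exact: dvdn_trans q_dv_Q (cardSg sQG).
have coPQ : coprime #|P| #|Q|.
  by rewrite (pnat_coprime pP) // (pi_pnat qQ) // !inE.
have ntPQ : [~: P, Q] != 1.
  by apply: contraNneq ncQP => /commG1P; rewrite centsC.
have nPQQ : Q \subset 'N([~: P, Q]) by rewrite commg_normr.
have [W minW sWPQ] := minnormal_exists ntPQ nPQQ.
have [/andP[ntW nWQ] irrW] := mingroupP minW.
have sWP : W \subset P by apply: subset_trans sWPQ _; rewrite commg_subl.
have pW := pgroupS sWP pP; have abW := abelianS sWP abP.
have cWQ1 : 'C_W(Q) = 1.
  by apply/trivgP; rewrite -(coprime_abel_cent_TI nPQ coPQ abP) setSI.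
(* [Q] fixes only the identity of [W], so [#|W|] is 1 modulo [q]; this is impossible for [p],
   because [1 < p < q]. *)
have neqWp : #|W| != p.
  apply: contraTneq isT => oW.
  have actQ : [acts Q, on W | 'J] by rewrite astabsJ.
  have := pgroup_fix_mod qQ actQ; rewrite afixJ cWQ1 cards1 oW.
  rewrite !modn_small ?prime_gt1 // => eqp1.
  by rewrite eqp1 in p_pr.
case/negP: ntW; rewrite -subG1 coreM // => g Gg; apply: contraT => nsWM.
have sWG := subset_trans sWP sPG; set Mg := M :^ g in nsWM.
have maxW := maxMg W g Gg sWG nsWM.
pose U := (W <*> Q)%G; have sUG : U \subset G by rewrite join_subG sWG.
have sWU : W \subset U := joing_subl W Q.
have nsUM : ~~ (U \subset Mg) by apply: contra nsWM; apply: subset_trans.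
have [ltUM maxU] := maxgroupP (maxMg U g Gg sUG nsUM).
have nWU : U \subset 'N(W) by rewrite join_subG normG.
have defU : W <*> (U :&: Mg) = U.
  apply/eqP; rewrite eqEproper join_subG sWU subsetIl /=.
  apply: contra nsWM => ltWU.
  have eqU := maxU (W <*> (U :&: M :^ g))%G ltWU (joing_subr _ _).
  by apply: subset_trans (joing_subl W (U :&: Mg)) _; rewrite eqU subsetIr.
(* Irreducibility now makes [W :&: Mg] trivial or all of [W]. It has index [p] in [W], so triviality
   would give [#|W| = p]. *)
have nWMU : U \subset 'N(W :&: Mg).
  rewrite -defU join_subG; apply/andP; split.
    by rewrite sub_abelian_norm ?subsetIl.
  have -> : W :&: Mg = W :&: (U :&: Mg) by rewrite setIA (setIidPl sWU).
  by rewrite normsI ?(normG (U :&: Mg)) // subIset ?nWU.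
have [W1 | ntWM] := eqsVneq (W :&: Mg) 1.
  by have := p_maximal_index pW maxW; rewrite /= -/Mg W1 indexg1 => /eqP/idPn[].
case/negP: nsWM; rewrite -(irrW (W :&: Mg)%G) ?subsetIl ?subsetIr //.
by rewrite ntWM (subset_trans (joing_subr W Q) nWMU).
Qed.

End MaximalModular.

Lemma cyclic_norm_der1_cent (gT : finGroupType) (H N : {group gT}) :
  cyclic N -> H \subset 'N(N) -> H^`(1) \subset 'C(N).
Proof.
move=> cycN nNH; rewrite -ker_conj_aut.
have nNH' : H^`(1) \subset 'N(N) := subset_trans (der_sub 1 H) nNH.
rewrite -sub_morphim_pre // morphim_der //.
by apply/trivgP/derG1P/(abelianS (Aut_conj_aut N H))/Aut_cyclic_abelian.
Qed.

(* If [M] is core-free and [N] is a proper minimal normal subgroup, induction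
   gives [N] a nontrivial solvable quotient, so [N] is abelian. Then [N :&: M]
   is trivial, [N] has prime order and [M] acts faithfully on it. *)
Lemma maximal_modular_core_sol (gT : finGroupType) (G M : {group gT}) :
    maximal M G -> modular_subgroup G M ->
  exists N : {group gT}, [/\ N <| G, N \subset M & solvable (G / N)].
Proof.
have [n] := ubnP #|G|; elim: n gT G M => // n IHn gT G M leGn maxM modM.
have [ltMG maxM'] := maxgroupP maxM; have sMG := proper_sub ltMG.
pose C := [group of gcore M G]; have nsCG : C <| G by apply: gcore_normal.
have sCM : C \subset M := gcore_sub M G.
have [C1 | ntC] := eqsVneq C 1; last first.
  have ltGCn : #|G / C| < n.
    have ltGC := ltn_quotient ntC (subset_trans sCM sMG).
    by rewrite -ltnS; apply: leq_ltn_trans ltGC leGn.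
  have maxMC : maximal (M / C) (G / C).
    by rewrite quotient_maximal // (normalS sCM sMG).
  have [Nb [nsNb sNbM solNb]] :=
    IHn _ _ _ ltGCn maxMC (modular_quotient nsCG modM).
  have [N defNb sCN nsNG] := inv_quotientN nsCG nsNb.
  exists N; split=> //; last first.
    by rewrite -(isog_sol (third_isog sCN nsCG nsNG)) -defNb.
  have nCN := subset_trans (normal_sub nsNG) (normal_norm nsCG).
  by rewrite -(quotientSGK nCN sCM) -defNb.
have [simG | nsimG] := boolP (simple G).
  exists 1%G; rewrite normal1 sub1G; split=> //.
  exact/quotient_sol/(simple_maximal_modular_sol simG maxM modM).
have ntG : G :!=: 1.
  by apply: contraTneq ltMG => ->; rewrite properE sub1G andbF.
have [N minN sNG] := minnormal_exists ntG (normG G).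
have [/andP[ntN nNG] irrN] := mingroupP minN.
have nsNG : N <| G by apply/andP.
have ltNG : N \proper G.
  rewrite properEneq sNG andbT; apply: contraNneq nsimG => eqNG.
  by rewrite /simple -{1}eqNG.
have nsNM : ~~ (N \subset M).
  apply: contra ntN => sNM; rewrite -subG1 -C1.
  exact: gcore_max.
have maxNM := modular_maximal_meet maxM modM sNG nsNM.
have modNM : modular_subgroup N (N :&: M).
  have -> : (N :&: M)%G = (M :&: N)%G by apply/val_inj/setIC.
  exact: modularS sNG modM.
have [N1 [nsN1 sN1M solN1]] :=
  IHn _ _ _ (leq_trans (proper_card ltNG) leGn) maxNM modNM.
(* Otherwise [N] is perfect by minimality, has no nontrivial solvable quotient, and so equals [N1],
   which lies in [M]. *)
have abN : abelian N.
  apply/derG1P; apply: contraTeq solN1 => ntN'.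
  have N'N : N^`(1) = N.
    apply: irrN (der_sub 1 N); rewrite ntN'.
    exact: char_norm_trans (der_char 1 N) nNG.
  apply: contra nsNM => solN1; apply: subset_trans (subsetIr N M).
  apply: subset_trans sN1M; rewrite -quotient_sub1 ?normal_norm //.
  apply: contraT; rewrite subG1 => ntNN1.
  have := sol_der1_proper solN1 (subxx _) ntNN1.
  by rewrite /= -(quotient_der 1 (normal_norm nsN1)) N'N properxx.
have defG : N <*> M = G.
  have sNMG : N <*> M \subset G by rewrite join_subG sNG.
  have [// | ltNM] := eqVproper sNMG; case/negP: nsNM.
  by rewrite -(maxM' (N <*> M)%G) ?joing_subl ?joing_subr.
have nNM : M \subset 'N(N) := subset_trans sMG nNG.
have NM1 : N :&: M = 1.
  apply: contraNeq nsNM => ntNM.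
  rewrite -(irrN (N :&: M)%G) ?subsetIl ?subsetIr //.
  rewrite ntNM -defG join_subG sub_abelian_norm ?subsetIl //=.
  by rewrite normsI ?normG.
have cycN : cyclic N.
  have [x Nx ntx] := trivgPn _ ntN.
  have [_ maxN1] := maxgroupP maxNM; apply/cyclicP; exists x.
  apply/eqP; rewrite eq_sym eqEproper cycle_subG Nx /=.
  apply: contra ntx => ltxN; rewrite -cycle_eq1.
  by rewrite -[<[x]>]/(gval <[x]>%G) (maxN1 <[x]>%G) /= ?NM1 ?sub1G.
exists 1%G; rewrite normal1 sub1G; split=> //; apply: quotient_sol.
rewrite (series_sol nsNG) abelian_sol // -defG quotientYidl // quotient_sol //.
apply: abelian_sol; apply/derG1P/trivgP.
(* The derived subgroup of [M] centralises the cyclic [N], so [N <*> M = G] normalises it and it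
   lies in the trivial core. *)
have sM'M := der_sub 1 M; rewrite -C1 gcore_max // -defG join_subG.
by rewrite cents_norm ?gFnorm // centsC cyclic_norm_der1_cent.
Qed.

(** * Solvable and perfect modular subgroups *)

Section ModularCycle.

Variable gT : finGroupType.
Implicit Types G H K L M N P X Y : {group gT}.

Lemma sub_pcycle_total (p : nat) (g : gT) H K : p.-elt g ->
  H \subset <[g]> -> K \subset <[g]> -> (H \subset K) || (K \subset H).
Proof.
move=> pg sHg sKg; have cycg := cycle_cyclic g.
rewrite -(cardSg_cyclic cycg sHg sKg) -(cardSg_cyclic cycg sKg sHg).
have [[i ->] [j ->]] := (p_natP (pgroupS sHg pg), p_natP (pgroupS sKg pg)).
have [leij | /ltnW leji] := leqP i j; first by rewrite dvdn_exp2l.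
by rewrite orbC dvdn_exp2l.
Qed.

(* By modularity the interval from [M] to [M <*> <[g]>] embeds into the chain
   of subgroups of [<[g]>], so all its members are modular in it. *)
Lemma modular_pcycle_ind G M (g : gT) (p : nat) (Q : {group gT} -> Prop) :
    modular_subgroup G M -> g \in G -> p.-elt g ->
    (forall L K, K \subset G -> maximal L K -> modular_subgroup K L ->
       Q L -> Q K) ->
  Q M -> Q (M <*> <[g]>)%G.
Proof.
move=> modM Gg pg Qstep QM; have sMG := modular_sub modM.
have [n] := ubnP #[g]; elim: n g Gg pg => // n IHn g Gg pg leg.
have sgG : <[g]> \subset G by rewrite cycle_subG.
pose K := (M <*> <[g]>)%G; have sKG : K \subset G by rewrite join_subG sMG.
have sMK : M \subset K := joing_subl _ _.
have [eqMK | [L maxL sML]] := maximal_exists sMK.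
  by have <- : M = (M <*> <[g]>)%G by apply: val_inj.
have ltLK := maxgroupp maxL; have sLK := proper_sub ltLK.
have modMK : modular_subgroup K M.
  have := modularS sKG modM; rewrite (_ : M :&: K = M)%G //.
  exact/val_inj/setIidPl.
have defX X : M \subset X -> X \subset K -> X :=: M <*> (<[g]> :&: X).
  move=> sMX sXK; apply/eqP; rewrite eqEsubset join_subG sMX subsetIr !andbT.
  have [_ _ modr] := modular_subgroupP _ _ modM.
  have := modr <[g]>%G X sgG (subset_trans sXK sKG) sMX.
  by rewrite (setIidPr sXK).
have totX X Y : M \subset X -> X \subset K -> M \subset Y -> Y \subset K ->
    (X \subset Y) || (Y \subset X).
  move=> sMX sXK sMY sYK; rewrite (defX X) // (defX Y) //.
  have := sub_pcycle_total pg (subsetIl <[g]> X) (subsetIl <[g]> Y).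
  by case/orP=> sXY; apply/orP; [left | right]; rewrite genS ?setUS.
have modL : modular_subgroup K L.
  apply: (modular_trans modMK sML sLK)
    => [X Y sMX sXY sYK | X Y sMX sXK sYK sLY].
    have sXK := subset_trans sXY sYK.
    have /orP[sLX | sXL] := totX L X sML sLK sMX sXK.
      by rewrite (joing_idPl sLX) subIset ?joing_subl.
    by rewrite (joing_idPr sXL) joing_subr.
  have /orP[sLX | sXL] := totX L X sML sLK sMX sXK.
    by rewrite (joing_idPr sLX) joing_subr.
  by rewrite (joing_idPl sXL) subIset ?joing_subl.
apply: Qstep sKG maxL modL _.
(* [L] is [M <*> <[h]>] with [h] of smaller order than [g], so induction reaches [L]. *)
have [h defC] := cyclicP (cyclicS (subsetIl _ L) (cycle_cyclic g)).
have -> : L = (M <*> <[h]>)%G by apply: val_inj; rewrite /= -defC; apply: defX.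
have ltC : <[h]> \proper <[g]>.
  rewrite -defC properE subsetIl subsetI subxx; apply: contraTN ltLK => sgL.
  by rewrite properE join_subG sML sgL andbF.
have sCg := proper_sub ltC; apply: IHn.
- by rewrite -cycle_subG (subset_trans sCg).
- exact: pgroupS pg.
exact: leq_trans (proper_card ltC) _.
Qed.

Lemma modular_join_pcycle_sol G M (g : gT) (p : nat) :
    modular_subgroup G M -> solvable M -> g \in G -> p.-elt g ->
  solvable (M <*> <[g]>).
Proof.
move=> modM solM Gg pg.
apply: (modular_pcycle_ind (Q := fun K => solvable K) modM Gg pg) => //.
move=> L K _ maxL modL solL.
have [N [nsNK sNL solKN]] := maximal_modular_core_sol maxL modL.
by rewrite (series_sol nsNK) solKN (solvableS sNL).
Qed.

Lemma perfect_quotient_sol G N P :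
  N <| G -> P \subset G -> P^`(1) = P -> solvable (G / N) -> P \subset N.
Proof.
move=> nsNG sPG perfP solGN; have nNP := subset_trans sPG (normal_norm nsNG).
rewrite -quotient_sub1 //; apply: contraT; rewrite subG1 => ntPN.
have := sol_der1_proper solGN (quotientS N sPG) ntPN.
by rewrite /= -(quotient_der 1 nNP) perfP properxx.
Qed.

(** Sylow subgroups generate [G]; this reduces invariance to elements of prime power order, where
    [modular_pcycle_ind] is available. *)
Lemma norm_pelt G A :
    (forall (p : nat) x, x \in G -> p.-elt x -> x \in 'N(A)) -> G \subset 'N(A).
Proof.
move=> nAx; rewrite -(Sylow_gen G) gen_subG; apply/bigcupsP=> P.
case/SylowP=> p _ /and3P[sPG pP _]; apply/subsetP=> x Px.
by apply: (nAx p); [apply: (subsetP sPG) | apply: mem_p_elt Px].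
Qed.

(* A maximal modular subgroup contains every perfect subgroup, since its core
   has a solvable quotient; so all perfect subgroups of [M <*> <[x]>] lie in
   [M], for [x] of prime power order. *)
Lemma perfect_sub_modular_core G M P :
    modular_subgroup G M -> P^`(1) = P -> P \subset M ->
  P \subset gcore M G.
Proof.
move=> modM perfP sPM.
pose T := <<\bigcup_(R : {group gT} | (R \subset M) && (R^`(1) :==: R)) R>>%G.
have sTM : T \subset M by rewrite gen_subG; apply/bigcupsP=> R /andP[].
suff nTG : G \subset 'N(T).
  apply: subset_trans (gcore_max sTM nTG); apply: sub_gen.
  by apply: (bigcup_max P); rewrite ?sPM /= ?perfP /= ?eqxx.
apply: norm_pelt => p x Gx px; rewrite inE -genJ gen_subG.
apply/subsetP=> _ /imsetP[y /bigcupP[R /andP[sRM /eqP perfR] Ry] ->].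
pose Q (K : {group gT}) := forall R' : {group gT},
  R' \subset K -> R'^`(1) = R' -> R' \subset M.
have perfx : Q (M <*> <[x]>)%G.
  apply: (modular_pcycle_ind modM Gx px) => // L K _ maxL modL QL.
  move=> R' sR'K perfR'.
  have [N [nsNK sNL solKN]] := maximal_modular_core_sol maxL modL.
  apply: QL (perfR'); apply: subset_trans sNL.
  exact: perfect_quotient_sol perfR' solKN.
apply: mem_gen; apply/bigcupP; exists (R :^ x)%G; last by rewrite memJ_conjg.
have perfRx : (R :^ x)^`(1) = R :^ x by rewrite derJ perfR.
rewrite /= perfRx eqxx andbT; apply: perfx perfRx; apply: conj_subG.
  by rewrite (subsetP (joing_subr M _)) ?cycle_id.
exact: subset_trans sRM (joing_subl _ _).
Qed.

Lemma joing_normal_sol G M N :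
  M <| G -> N <| G -> solvable M -> solvable N -> solvable (M <*> N).
Proof.
move=> /andP[sMG nMG] /andP[sNG _] solM solN.
have nMN := subset_trans sNG nMG.
have nsMMN : M <| M <*> N by rewrite /normal joing_subl join_subG normG.
by rewrite (series_sol nsMMN) solM quotientYidl ?quotient_sol.
Qed.

(** Take [S] maximal among the solvable modular subgroups containing [M]. For [x] of prime power
    order, [S <*> S :^ x] is modular and lies in the solvable [S <*> <[x]>], so it equals [S]. *)
Lemma sol_modular_sub_normal G M :
    modular_subgroup G M -> solvable M ->
  exists S : {group gT}, [/\ S <| G, solvable S & M \subset S].
Proof.
move=> modM solM; pose Q (S : {group gT}) := modular_subgroup G S && solvable S.
have [|S /maxgroupP[/andP[modS solS] maxS] sMS] := @maxgroup_exists _ Q M.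
  by rewrite /Q modM.
have sSG := modular_sub modS; exists S; split=> //; rewrite /normal sSG.
apply: norm_pelt => p x Gx px; rewrite inE -{2}(maxS (S <*> S :^ x)%G) /=.
- exact: joing_subr.
- rewrite /Q modularY ?modularJ ?(subsetP (normG G)) //=.
  apply: solvableS (modular_join_pcycle_sol modS solS Gx px).
  rewrite join_subG joing_subl conj_subG ?joing_subl //.
  by rewrite (subsetP (joing_subr S _)) ?cycle_id.
exact: joing_subl.
Qed.

(** A minimal nonsolvable subgroup is perfect. *)
Lemma nonsolvable_perfect_sub G : ~~ solvable G ->
  exists P : {group gT}, [/\ P \subset G, P^`(1) = P & P :!=: 1].
Proof.
move=> nsolG.
have [P /mingroupP[nsolP minP] sPG] :=
  @mingroup_exists _ (fun P : {group gT} => ~~ solvable P) G nsolG.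
exists P; split=> //; last by apply: contraNneq nsolP => ->; apply: solvable1.
apply: (minP [group of P^`(1)]); last exact: der_sub.
apply: contra nsolP => solP'; rewrite (series_sol (der_normal 1 P)) solP'.
exact/abelian_sol/sub_der1_abelian.
Qed.

(** If [M :&: N] is solvable, it lies in a maximal solvable normal subgroup of [N]; this is
    [G]-invariant, hence trivial. Otherwise [M :&: N] has a nontrivial perfect subgroup, which lies
    in the core of [M], so that core contains [N]. *)
Lemma modular_minnormal_nonsol G M N :
    minnormal N G -> N \subset G -> ~~ solvable N -> modular_subgroup G M ->
  M :&: N = 1 \/ N \subset M.
Proof.
case/mingroupP=> /andP[ntN nNG] irrN sNG nsolN modM.
have [solD | nsolD] := boolP (solvable (M :&: N)); [left | right].
  have [S [nsSN solS sDS]] := sol_modular_sub_normal (modularS sNG modM) solD.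
  pose Q (T : {group gT}) := (T <| N) && solvable T.
  have [|T /maxgroupP[/andP[nsTN solT] maxT] sST] := @maxgroup_exists _ Q S.
    by rewrite /Q nsSN.
  have nTG : G \subset 'N(T).
    apply/subsetP=> x Gx; rewrite inE.
    rewrite -{2}(maxT (T <*> T :^ x)%G) ?joing_subl ?joing_subr //.
    have nsTxN : T :^ x <| N by rewrite -(normP (subsetP nNG x Gx)) normalJ.
    rewrite /Q /= normalY //= (joing_normal_sol nsTN nsTxN) //.
    by rewrite (isog_sol (conj_isog T x)) in solT *.
  apply/trivgP; apply: subset_trans sDS _; apply: subset_trans sST _.
  rewrite subG1; apply: contraNT nsolN => ntT.
  by rewrite -(irrN T) ?(normal_sub nsTN) // (ntT : T :!=: 1).
have [P [sPD perfP ntP]] := nonsolvable_perfect_sub nsolD.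
have [sPM sPN] := subsetIP sPD.
have sPcore := perfect_sub_modular_core modM perfP sPM.
pose C := (gcore M G :&: N)%G.
have eqCN : C :=: N.
  apply: irrN (subsetIr _ _); rewrite normsI ?gcore_norm // andbT.
  by apply: contraNneq ntP => C1; rewrite -subG1 -C1 subsetI sPcore.
by rewrite -eqCN subIset // gcore_sub.
Qed.

End ModularCycle.

(** * Modular subgroups and abelian minimal normal subgroups *)

Section AbelianMinnormal.

Variable gT : finGroupType.
Implicit Types G H M N P Q V : {group gT}.

(** By the second law [(M <*> H) :&: (M <*> V)] lies in [M], and it contains every [H]-conjugate of
    [M :&: V]. *)
Lemma modular_meet_norm G M V H :
    modular_subgroup G M -> V \subset G -> H \subset G -> H \subset 'N(V) ->
    H :&: (M <*> V) \subset M ->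
  H \subset 'N(M :&: V).
Proof.
move=> modM sVG sHG nVH sHM; have [sMG _ modr] := modular_subgroupP _ _ modM.
have sMVG : M <*> V \subset G by rewrite join_subG sMG.
have sM : (M <*> H) :&: (M <*> V) \subset M.
  apply: subset_trans (modr H (M <*> V)%G sHG sMVG (joing_subl _ _)) _.
  by rewrite join_subG subxx.
apply/subsetP=> h Hh; rewrite inE subsetI.
have sVh : (M :&: V) :^ h \subset V.
  by rewrite -{2}(normP (subsetP nVH h Hh)) conjSg subsetIr.
rewrite sVh andbT; apply: subset_trans sM; rewrite subsetI; apply/andP; split.
  rewrite conj_subG ?(subsetP (joing_subr M H)) //.
  exact: subset_trans (subsetIl _ _) (joing_subl _ _).
exact: subset_trans sVh (joing_subr _ _).
Qed.

Lemma pprime_conj_meet (p q : nat) M V Q :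
    M \subset 'N(V) -> p.-group V -> q.-group Q -> q != p ->
  exists2 v, v \in V & (Q :^ v) :&: (M <*> V) \subset M.
Proof.
move=> nVM pV qQ neqp; pose K := (M <*> V)%G.
have q'V : q^'.-group V.
  by apply: sub_pgroup pV => r /eqnP->; rewrite !inE eq_sym.
have [S sylS] := Sylow_exists q M; have [sSM qS _] := and3P sylS.
have defK : V * M = K by rewrite -normC //= norm_joinEl.
have sMK : M \subset K := joing_subl M V.
have sylSK : q.-Sylow(K) S.
  apply/and3P; split=> //; first exact: subset_trans sSM sMK.
  rewrite -(Lagrange_index sMK sSM) pnatM; case/and3P: sylS => _ _ ->.
  rewrite andbT /= norm_joinEl // indexMg.
  exact: pnat_dvd (dvdn_indexg _ _) q'V.
have [x] := Sylow_Jsub sylSK (subsetIr Q K) (pgroupS (subsetIl Q K) qQ).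
rewrite -{1}defK => /mulsgP[v m Vv Mm ->] sQx; exists v => //.
have Kv : v \in K by rewrite (subsetP (joing_subr M V)).
rewrite -/(gval K) -(normP (subsetP (normG K) v Kv)) -conjIg.
rewrite -(conjSg _ _ m) -conjsgM (conjGid Mm).
exact: subset_trans sQx sSM.
Qed.

Lemma pprime_norm_modular (p q : nat) G M N Q :
    modular_subgroup G M -> N <| G -> p.-group N -> abelian N ->
    Q \subset G -> q.-group Q -> q != p ->
  Q \subset 'N(M :&: N).
Proof.
move=> modM /andP[sNG nNG] pN abN sQG qQ neqp.
have nNM := subset_trans (modular_sub modM) nNG.
have [v Nv sQvM] := pprime_conj_meet nNM pN qQ neqp.
have Gv := subsetP sNG v Nv.
have nDv : v \in 'N(M :&: N).
  by rewrite (subsetP (sub_abelian_norm abN (subsetIr M N))).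
have sQvG : (Q :^ v)%G \subset G by rewrite conj_subG.
rewrite -(conjSg _ _ v) -normJ (normP nDv).
exact: modular_meet_norm modM sNG sQvG (subset_trans sQvG nNG) sQvM.
Qed.

(* [M <*> Q] has the same intersection with [V] as [M]. The Frattini argument
   then gives [M <*> Q = (M :&: V) * (M <*> Q :&: H)], so that
   [H :&: (M <*> V) \subset M] and [modular_meet_norm] applies. *)
Lemma modular_split_norm (p q : nat) G M V H Q :
    modular_subgroup G M -> V <| G -> p.-group V ->
    V <*> H = G -> H :&: V = 1 ->
    Q \subset G -> 'N_G(Q) = H -> q.-group Q -> q != p ->
    Q \subset 'N(M :&: V) -> Q :&: (M <*> V) \subset M ->
  H \subset 'N(M :&: V).
Proof.
move=> modM nsVG pV defG tiHV sQG defH qQ neqp nDQ sQM.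
have [sMG _ modr] := modular_subgroupP _ _ modM; have [sVG nVG] := andP nsVG.
have sHG : H \subset G by rewrite -defH subsetIl.
have nQH : H \subset 'N(Q) by rewrite -defH subsetIr.
have q'V : q^'.-group V.
  by apply: sub_pgroup pV => r /eqnP->; rewrite !inE eq_sym.
have sQH : Q \subset H by rewrite -defH subsetI sQG normG.
have nVQ := subset_trans sQG nVG.
have nVM := subset_trans sMG nVG.
pose VQ := (V <*> Q)%G; have sVQ : V \subset VQ := joing_subl V Q.
have sQVQ : Q \subset VQ := joing_subr V Q.
have sVQG : VQ \subset G by rewrite join_subG sVG.
have nsVQG : VQ <| G.
  rewrite /normal sVQG -{1}defG join_subG (subset_trans sVQ (normG _)) /=.
  by rewrite normsY // (subset_trans sHG).
have sylQ : q.-Sylow(VQ) Q.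
  apply/and3P; split=> //; rewrite /= norm_joinEr // -normC // indexMg.
  exact: pnat_dvd (dvdn_indexg _ _) q'V.
pose M1 := (M <*> Q)%G; have sMM1 : M \subset M1 := joing_subl M Q.
have sQM1 : Q \subset M1 := joing_subr M Q.
have sM1G : M1 \subset G by rewrite join_subG sMG.
have sMVG : M <*> V \subset G by rewrite join_subG sMG.
have sM1M : M1 :&: (M <*> V) \subset M.
  apply: subset_trans (modr Q (M <*> V)%G sQG sMVG (joing_subl _ _)) _.
  by rewrite join_subG subxx.
pose R := (VQ :&: M1)%G.
have nsRM1 : R <| M1.
  rewrite /normal subsetIr normsI ?normG //.
  exact: subset_trans sM1G (normal_norm nsVQG).
have sQR : Q \subset R by rewrite subsetI sQVQ.
have sylQR : q.-Sylow(R) Q := pHall_subl sQR (subsetIl _ _) sylQ.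
have sM1VH : M1 \subset V * (M1 :&: H).
  rewrite -{1}(Frattini_arg nsRM1 sylQR).
  apply: subset_trans (mulSg _ (subsetIl _ _)) _.
  rewrite /VQ /= norm_joinEr // -mulgA mulgS //.
  have sNH : 'N_M1(Q) \subset M1 :&: H.
    by rewrite -defH setIA (setIidPl sM1G).
  have sQM1H : Q \subset M1 :&: H by rewrite subsetI sQM1.
  exact: (mul_subG (G := (M1 :&: H)%G)).
have sHM : H :&: (M <*> V) \subset M1.
  apply: (@subset_trans _ _ (M1 :&: H)); last exact: subsetIl.
  rewrite norm_joinEl // normC //.
  apply: subset_trans (setIS H (mulgS V (subset_trans sMM1 sM1VH))) _.
  by rewrite mulgA mulGid -group_modr ?subsetIr // tiHV mul1g.
apply: modular_meet_norm modM sVG sHG (subset_trans sHG nVG) _.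
by apply: subset_trans sM1M; rewrite subsetI sHM subsetIr.
Qed.

(** With [V = [~: N, Q]] and [H = 'N_G(Q)], elements of [H :&: V] commute with [Q], while coprime
    action gives ['C_V(Q) = 1]. So [V <*> H] splits, and [modular_split_norm] applies there after
    conjugating by some [v] in the abelian [V], which normalises [M :&: V]. *)
Lemma pprime_normaliser_modular (p q : nat) G M N Q :
    modular_subgroup G M -> N <| G -> p.-group N -> abelian N ->
    Q \subset G -> q.-group Q -> q != p ->
  'N_G(Q) \subset 'N(M :&: [~: N, Q]).
Proof.
move=> modM nsNG pN abN sQG qQ neqp; have [sNG nNG] := andP nsNG.
have nNQ := subset_trans sQG nNG.
pose H := 'N_G(Q)%G; pose V := [~: N, Q]%G.
have sHG : H \subset G := subsetIl _ _.
have sVN : V \subset N by rewrite commg_subl.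
have sVG := subset_trans sVN sNG; have pV := pgroupS sVN pN.
have nVH : H \subset 'N(V).
  by apply: normsR; [apply: subset_trans nNG | apply: subsetIr].
have coNQ : coprime #|N| #|Q|.
  by rewrite (pnat_coprime pN) // (pi_pnat qQ) // !inE.
have tiNQ : N :&: Q = 1 := coprime_TIg coNQ.
have cVQ1 : 'C_V(Q) = 1 := coprime_abel_cent_TI nNQ coNQ abN.
have tiHV : H :&: V = 1.
  apply/trivgP; rewrite -cVQ1 subsetI subsetIr /=; apply/commG1P/trivgP.
  rewrite -tiNQ; apply: commg_subI; rewrite subsetI.
    by rewrite (subset_trans (subsetIr _ _) sVN) subIset ?subsetIr.
  by rewrite subxx.
pose G1 := (V <*> H)%G; have sG1G : G1 \subset G by rewrite join_subG sVG.
have sVG1 : V \subset G1 := joing_subl V H.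
have sHG1 : H \subset G1 := joing_subr V H.
have nVG1 : G1 \subset 'N(V) by rewrite join_subG normG.
have sQH : Q \subset H by rewrite subsetI sQG normG.
pose M1 := (M :&: G1)%G; have modM1 := modularS sG1G modM.
have nVM1 : M1 \subset 'N(V) by rewrite subIset // nVG1 orbT.
have [v Vv sQvM] := pprime_conj_meet nVM1 pV qQ neqp.
have nDv : v \in 'N(M :&: V).
  by rewrite (subsetP (sub_abelian_norm (abelianS sVN abN) (subsetIr M V))).
have G1v := subsetP sVG1 v Vv.
have defG1 : V <*> (H :^ v) = G1.
  by rewrite -{1}(conjGid Vv) -conjYg (conjGid G1v).
have tiHvV : (H :^ v) :&: V = 1.
  by rewrite -{1}(conjGid Vv) -conjIg tiHV conjs1g.
have sQvG1 : (Q :^ v)%G \subset G1.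
  by rewrite conj_subG // (subset_trans sQH).
have defH : 'N_G1(Q :^ v) = H :^ v.
  rewrite normJ -{1}(conjGid G1v) -conjIg; congr (_ :^ v).
  by apply/eqP; rewrite eqEsubset setSI //= subsetI sHG1 subsetIr.
have qQv : q.-group (Q :^ v) by rewrite pgroupJ.
have defD : M1 :&: V = M :&: V by rewrite -setIA (setIidPr sVG1).
have nDQ : Q :^ v \subset 'N(M1 :&: V).
  rewrite defD -(setIidPr sVN) setIA normsI //.
    have sQvG := subset_trans sQvG1 sG1G.
    exact: pprime_norm_modular modM nsNG pN abN sQvG qQv neqp.
  exact: subset_trans sQvG1 nVG1.
have nsVG1 : V <| G1 by apply/andP.
have := modular_split_norm (H := (H :^ v)%G) (Q := (Q :^ v)%G)
  modM1 nsVG1 pV defG1 tiHvV sQvG1 defH qQv neqp nDQ sQvM.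
by rewrite defD /= -{1}(normP nDv) normJ conjSg.
Qed.

(* The subgroups [M :&: [~: N, Q]], for [Q] a Sylow p'-subgroup, generate a
   normal subgroup of [G] contained in [M :&: N]. If it is trivial, then the
   p'-elements centralise [M :&: N], hence [N], and so [N] is central. *)
Lemma modular_minnormal_abelian (p : nat) G M N :
    minnormal N G -> N \subset G -> p.-group N -> abelian N ->
    modular_subgroup G M ->
  M :&: N = 1 \/ N \subset M.
Proof.
case/mingroupP=> /andP[ntN nNG] irrN sNG pN abN modM.
have nsNG : N <| G by apply/andP.
have [D1 | ntD] := eqsVneq (M :&: N) 1; [by left | right].
pose D := (M :&: N)%G; have [sDM sDN] := subsetIP (subxx D).
(* [S] selects the nontrivial Sylow subgroups for primes other than [p]. *)
pose S Q := Sylow G Q && ~~ p.-group Q.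
have SP Q : S Q -> exists q : nat, [/\ q.-Sylow(G) Q, q.-group Q & q != p].
  case/andP=> /SylowP[q _ sylQ] npQ; have qQ := pHall_pgroup sylQ.
  by exists q; split=> //; apply: contraNneq npQ => <-.
have SJ Q x : x \in G -> S Q -> S (Q :^ x)%G.
  move=> Gx /andP[sylQ npQ]; rewrite /S pgroupJ npQ andbT.
  have [q q_pr sylQq] := SylowP _ _ sylQ.
  by apply/SylowP; exists q; rewrite // pHallJ.
pose A := <<\bigcup_(Q | S Q) Q>>%G.
have sSA Q : S Q -> Q \subset A by move=> SQ; apply/sub_gen/bigcup_sup.
have sAG : A \subset G.
  rewrite gen_subG; apply/bigcupsP=> Q /SP[q [sylQ _ _]]; exact: pHall_sub sylQ.
have nAG : G \subset 'N(A).
  apply/subsetP=> x Gx; rewrite inE -genJ gen_subG.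
  apply/subsetP=> _ /imsetP[y /bigcupP[Q SQ Qy] ->].
  by apply: (subsetP (sSA _ (SJ Q x Gx SQ))); rewrite memJ_conjg.
have nDA : A \subset 'N(D).
  rewrite gen_subG; apply/bigcupsP=> Q /SP[q [sylQ qQ neqp]].
  exact: pprime_norm_modular modM nsNG pN abN (pHall_sub sylQ) qQ neqp.
pose T := <<\bigcup_(Q | S Q) (M :&: [~: N, Q])>>%G.
have sST Q : S Q -> M :&: [~: N, Q] \subset T.
  by move=> SQ; apply/sub_gen/(bigcup_max Q).
have sTD : T \subset D.
  rewrite gen_subG; apply/bigcupsP=> Q /SP[q [sylQ _ _]]; rewrite setIS //.
  by rewrite commg_subl (subset_trans (pHall_sub sylQ)).
have nTG : G \subset 'N(T).
  apply/subsetP=> x Gx; rewrite inE -genJ gen_subG.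
  apply/subsetP=> _ /imsetP[y /bigcupP[Q SQ Qy] ->].
  apply: (subsetP (sST _ (SJ Q x Gx SQ))).
  have [q [sylQ qQ neqp]] := SP Q SQ.
  have sQG := pHall_sub sylQ; have nNQ := subset_trans sQG nNG.
  have nsAG : A <| G by apply/andP.
  have sylQA := pHall_subl (sSA Q SQ) sAG sylQ.
  have defG : 'N_G(Q) * A = G.
    rewrite normC ?(Frattini_arg nsAG sylQA) //.
    exact: subset_trans (subsetIl _ _) nAG.
  have nH := pprime_normaliser_modular modM nsNG pN abN sQG qQ neqp.
  (* The factor [h] preserves [M :&: [~: N, Q]], and [a] then keeps the element in [M] because [A]
     normalises [D]. *)
  move: Gx; rewrite -{1}defG => /mulsgP[h a Hh Aa ->] /=.
  have [Gh nQh] := setIP Hh; rewrite conjgM conjsgM (normP nQh).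
  have {Qy} : y ^ h \in M :&: [~: N, Q] by rewrite memJ_norm ?(subsetP nH).
  case/setIP=> My NQy; have Dy : y ^ h \in D.
    by rewrite inE My (subsetP _ _ NQy) // commg_subl.
  rewrite inE; apply/andP; split.
    by apply: (subsetP sDM); rewrite memJ_norm ?(subsetP nDA).
  have nNa := subsetP nNG a (subsetP sAG a Aa).
  by rewrite -{1}(normP nNa) -conjsRg memJ_conjg.
have [T1 | ntT] := eqsVneq T 1; last first.
  by rewrite -(irrN T) ?(subset_trans sTD) // ntT.
have cDS Q : S Q -> Q \subset 'C(D).
  move=> SQ; have [q [sylQ qQ neqp]] := SP Q SQ.
  rewrite centsC; apply/commG1P/trivgP; rewrite -T1.
  apply: subset_trans (sST Q SQ); rewrite subsetI commSg // andbT.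
  apply: subset_trans sDM; rewrite commg_subl.
  exact: subset_trans (sSA Q SQ) nDA.
have cNA : 'C_N(A) = N.
  apply: (irrN 'C_N(A)%G); rewrite ?subsetIl // normsI ?norms_cent // andbT.
  apply: contraNneq ntD => cNA1; rewrite -subG1 -cNA1 subsetI sDN centsC.
  by rewrite gen_subG; apply/bigcupsP.
have [P sylP] := Sylow_exists p G; have [sPG pP _] := and3P sylP.
have sNP : N \subset P.
  exact: subset_trans (pcore_max pN nsNG) (pcore_sub_Hall sylP).
have ntZ : N :&: 'Z(P) != 1.
  by rewrite meet_center_nil ?(pgroup_nil pP) // (normalS sNP sPG).
(* For every prime some Sylow subgroup centralises [N :&: 'Z(P)]: [P] does for [p], and the others
   are trivial or lie in [A]. Hence no prime divides the index of the centraliser. *)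
have cZG : G \subset 'C(N :&: 'Z(P)).
  pose C := 'C_G(N :&: 'Z(P))%G; have sCG : C \subset G := subsetIl _ _.
  suff <- : C = G by apply: subsetIr.
  apply/val_inj/eqP; rewrite eqEsubset sCG -indexg_eq1; apply: contraT => neq1.
  have lt1 : 1 < #|G : C| by rewrite ltn_neqAle eq_sym neq1 indexg_gt0.
  have r_pr := pdiv_prime lt1; set r := pdiv _ in r_pr.
  have [R sylR cR] : exists2 R : {group gT},
      r.-Sylow(G) R & R \subset 'C(N :&: 'Z(P)).
    have [-> | neqrp] := eqVneq r p.
      exists P => //; rewrite centsC.
      exact: subset_trans (subsetIr _ _) (subsetIr _ _).
    have [R sylR] := Sylow_exists r G; exists R => //.
    have [pR | npR] := boolP (p.-group R).
      suff -> : R :=: 1 by apply: sub1G.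
      apply/card1_trivg/(pnat_1 pR)/(sub_in_pnat _ (pHall_pgroup sylR)).
      by move=> t _ /eqnP->; rewrite !inE.
    rewrite centsC (subset_trans (subsetIl _ _)) // -cNA subIset //.
    rewrite centS ?orbT //.
    by apply: sSA; rewrite /S npR (p_Sylow sylR).
  have sRC : R \subset C by rewrite subsetI (pHall_sub sylR).
  have [_ _ r'R] := and3P sylR.
  have : r^'.-nat #|G : C| := pnat_dvd (indexgS G sRC) r'R.
  by rewrite p'natE // pdiv_dvd.
have defN : N :&: 'Z(P) = N.
  apply: (irrN (N :&: 'Z(P))%G); rewrite ?subsetIl // ntZ.
  exact: cents_norm.
rewrite -(irrN D) ?ntD //= cents_norm // (subset_trans cZG) // centS //.
by rewrite defN.
Qed.

End AbelianMinnormal.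

(** * Chief series *)

Section Chief.

Variable gT : finGroupType.
Implicit Types G H K L M N P U V W F : {group gT}.

Lemma modular_minnormal G M N :
    minnormal N G -> N \subset G -> modular_subgroup G M ->
  M :&: N = 1 \/ N \subset M.
Proof.
move=> minN sNG modM; have [solN | nsolN] := boolP (solvable N); last first.
  exact: modular_minnormal_nonsol minN sNG nsolN modM.
have [_ _ /is_abelemP[p _ abelN]] := minnormal_solvable minN (subxx N) solN.
have [pN abN] := (abelem_pgroup abelN, abelem_abelian abelN).
exact: modular_minnormal_abelian minN sNG pN abN modM.
Qed.

End Chief.

Section ChiefSeries.

Variable gT : finGroupType.
Implicit Types G H K L M N P U V W F : {group gT}.

(** Passing to [G / V] turns the minimal normal dichotomy into the jump condition along a chief
    series. *)
Lemma modular_chief_factor G M U V :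
    chief_factor G V U -> modular_subgroup G M -> ~~ (U :&: M \subset V) ->
  U \subset V <*> M.
Proof.
move=> chiefUV modM nsUMV; have minUV := chief_factor_minnormal chiefUV.
have/andP[maxV /andP[sUG _]] := chiefUV.
have/andP[ltVU nVG] := maxgroupp maxV; have sVU := proper_sub ltVU.
have nsVG : V <| G by rewrite /normal (subset_trans sVU).
have nVM := subset_trans (modular_sub modM) nVG.
have nVU := subset_trans sUG nVG.
have [MU1 | ] :=
  modular_minnormal minUV (quotientS V sUG) (modular_quotient nsVG modM).
  case/negP: nsUMV; rewrite -quotient_sub1 ?subIset ?nVU //.
  by rewrite -MU1 setIC quotientI.
by rewrite quotientSK // norm_joinEr.
Qed.

Lemma card_modular_chain G (c : seq {group gT}) (C : {set {group gT}}) :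
    G.-chief.-series 1%G c -> last 1%G c = G -> subgroup_chain G C ->
    (forall M, M \in C -> modular_subgroup G M) ->
  #|C| <= (size c).+1.
Proof.
move=> chief_c last_c chC modC.
have lt_c : path (fun H K => H \proper K) 1%G c.
  by apply: sub_path chief_c => H K /andP[/maxgroupp/andP[]].
pose x := nth 1%G (1%G :: c).
have xn : x (size c) = G by rewrite /x nth_last.
have sxG i : i <= size c -> x i \subset G.
  by move=> lei; rewrite -xn proper_series_sub.
apply: (card_chain_jumps (erefl _) xn sxG chC modC) => M i CM.
rewrite inE; apply: modular_chief_factor (modC M CM).
by have/(pathP 1%G)/(_ i (ltn_ord i)) := chief_c.
Qed.

(** Otherwise minimality gives [[~: U / V, F / V] = U / V], so [U / V] lies in the nilpotent
    [F / V], where such commutators are proper. *)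
Lemma nilpotent_cent_chief G F U V :
  F <| G -> nilpotent F -> chief_factor G V U -> [~: U, F] \subset V.
Proof.
move=> /andP[sFG nFG] nilF chiefUV.
have minUV := chief_factor_minnormal chiefUV.
have/andP[maxV /andP[sUG nUG]] := chiefUV.
have/andP[ltVU nVG] := maxgroupp maxV; have sVU := proper_sub ltVU.
have nVF := subset_trans sFG nVG; have nVU := subset_trans sUG nVG.
rewrite -quotient_cents2 //; apply/commG1P; apply: contraTeq nilF => ntR.
have [/andP[ntUV nUVG] irrUV] := mingroupP minUV.
have defUV : [~: U / V, F / V] = U / V.
  apply: (irrUV [~: U / V, F / V]%G).
    by rewrite ntR normsR ?quotient_norms.
  by rewrite commg_subl (subset_trans (quotientS _ sFG)).
have sUVF : U / V \subset F / V.
  rewrite -defUV commg_subr.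
  exact: subset_trans (quotientS V sUG) (quotient_norms V nFG).
apply/negP=> nilF; have nUVF : F / V \subset 'N_(F / V)(U / V).
  by rewrite subsetI subxx (subset_trans (quotientS V sFG)).
have := nil_comm_properl (quotient_nil V nilF) sUVF ntUV nUVF.
by rewrite defUV properxx.
Qed.

Lemma pgroup_quotient_Sylow (p : nat) G N P :
  N <| G -> p.-group (G / N) -> p.-Sylow(G) P -> G \subset N * P.
Proof.
move=> nsNG pGN sylP; have [sPG _ _] := and3P sylP.
have nNG := normal_norm nsNG; rewrite -quotientSK //.
have sylPN := quotient_pHall (subset_trans sPG nNG) sylP.
by rewrite (pHall_id sylPN pGN).
Qed.

(** For [K / 'F(G)] an abelian normal p-subgroup and [P] Sylow in [K], Frattini gives
    [G = 'F(G) * 'N_G(P)]. The normaliser is proper, since a normal [P] would lie in ['F(G)]. *)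
Lemma sol_maximal_Fitting_supplement G : solvable G -> G :!=: 1 ->
  exists2 M : {group gT}, maximal M G & 'F(G) <*> M = G.
Proof.
move=> solG ntG; have [sFG nFG] := andP (Fitting_normal G).
suff [H ltHG defG] :
    exists2 H : {group gT}, H \proper G & G \subset 'F(G) <*> H.
  have [eqHG | [M maxM sHM]] := maximal_exists (proper_sub ltHG).
    by rewrite eqHG properxx in ltHG.
  exists M => //; apply/eqP; rewrite eqEsubset join_subG sFG.
  rewrite (proper_sub (maxgroupp maxM)) /=.
  by apply: subset_trans defG _; rewrite genS ?setUS.
have [eqFG | neqFG] := eqsVneq 'F(G) G.
  by exists 1%G; rewrite ?proper1G // joingG1 /= eqFG.
have nsFG := Fitting_normal G.
have ntGF : G / 'F(G) != 1.
  apply: contraNneq neqFG => GF1; rewrite eqEsubset sFG.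
  by rewrite /= -quotient_sub1 ?nFG // GF1 sub1G.
have [Kb [sKbG nsKb ntKb /is_abelemP[p p_pr abelKb]]] :=
  solvable_norm_abelem (quotient_sol _ solG) (normal_refl _) ntGF.
have [K defK sFK nsKG] := inv_quotientN nsFG nsKb.
have [P sylP] := Sylow_exists p K; have [sPK pP _] := and3P sylP.
have sKFP : K \subset 'F(G) * P.
  apply: pgroup_quotient_Sylow sylP.
    exact: normalS sFK (normal_sub nsKG) nsFG.
  by rewrite -defK (abelem_pgroup abelKb).
have sPG := subset_trans sPK (normal_sub nsKG).
exists 'N_G(P)%G.
  rewrite properEneq subsetIl andbT; apply: contraNneq ntKb => eqN.
  have nsPG : P <| G by rewrite /normal sPG -{1}eqN subsetIr.
  rewrite defK -subG1 quotient_sub1; last first.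
    exact: subset_trans (normal_sub nsKG) nFG.
  apply: subset_trans sKFP _; rewrite mul_subG //.
  by rewrite Fitting_max ?(pgroup_nil pP).
rewrite -{1}(Frattini_arg nsKG sylP); apply: subset_trans (mulSg _ sKFP) _.
rewrite -mulgA mulSGid ?subsetI ?sPG ?normG //.
by rewrite mul_subG ?joing_subl ?joing_subr.
Qed.

Section Supplement.

Variables G M F : {group gT}.
Hypotheses (maxM : maximal M G) (nsFG : F <| G) (nilF : nilpotent F).
Hypothesis defG : F <*> M = G.

Let sMG : M \subset G. Proof. exact: proper_sub (maxgroupp maxM). Qed.

Lemma supplement_norm U V W : chief_factor G V U ->
  V \subset W -> W \subset U -> M \subset 'N(W) -> G \subset 'N(W).
Proof.
move=> chiefUV sVW sWU nWM; rewrite -defG join_subG nWM andbT -commg_subl.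
apply: subset_trans (commSg F sWU) (subset_trans _ sVW).
exact: nilpotent_cent_chief nsFG nilF chiefUV.
Qed.

(** [V <*> (M :&: U)] is [M]-invariant, hence [G]-invariant, so it is [V] or [U]. In the first case
    the factor vanishes in [M]; in the second it survives and Dedekind's law transfers its
    irreducibility. *)
Lemma supplement_chief_factor U V : V <| G -> chief_factor G V U ->
  [\/ M :&: U = M :&: V /\ ~~ (U \subset M)
    | chief_factor M (M :&: V) (M :&: U) /\ (V \subset M -> U \subset M)].
Proof.
move=> /andP[sVG nVG] chiefUV.
have/andP[maxV /andP[sUG nUG]] := chiefUV.
have [/andP[ltVU _] maxV'] := maxgroupP maxV; have sVU := proper_sub ltVU.
have nVU := subset_trans sUG nVG.
have [nVM nUM] := (subset_trans sMG nVG, subset_trans sMG nUG).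
have dich W : V \subset W -> W \subset U -> M \subset 'N(W) ->
    W :=: V \/ W :=: U.
  move=> sVW sWU nWM; have [eqWU | ltWU] := eqVproper sWU; [by right | left].
  by apply: maxV' => //; rewrite ltWU (supplement_norm chiefUV).
have join_norm L : M \subset 'N(L) -> M \subset 'N(V <*> L).
  by move=> nLM; rewrite normsY.
have sVL L : L \subset M :&: U -> V <*> L \subset U.
  by move=> sL; rewrite join_subG sVU (subset_trans sL) ?subsetIr.
have nMU : M \subset 'N(M :&: U) by rewrite normsI ?normG.
have nMV : M \subset 'N(M :&: V) by rewrite normsI ?normG.
have sMVU : M :&: V \subset M :&: U by rewrite setIS.
have [eqV | eqU] :=
  dich _ (joing_subl V (M :&: U)) (sVL _ (subxx _)) (join_norm _ nMU).
  left; have sMUV : M :&: U \subset V by rewrite -eqV joing_subr.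
  split; first by apply/eqP; rewrite eqEsubset sMVU subsetI subsetIl sMUV.
  apply: contraL ltVU => sUM; rewrite properE negb_and negbK orbC.
  by rewrite -{1}(setIidPr sUM) sMUV.
right; split; last by move=> sVM; rewrite -eqU join_subG sVM subsetIl.
rewrite /chief_factor /normal subsetIl nMU !andbT.
apply/maxgroupP; split=> [|L /andP[ltL nLM] sL].
  rewrite nMV andbT properE sMVU; apply: contraL ltVU => sMUV.
  rewrite properE negb_and negbK orbC -eqU join_subG subxx.
  by rewrite (subset_trans sMUV) ?subsetIr.
have sLU := proper_sub ltL; have sLM := subset_trans sLU (subsetIl _ _).
have [eqV | eqUL] := dich _ (joing_subl V L) (sVL _ sLU) (join_norm _ nLM).
  by apply/eqP; rewrite eqEsubset sL subsetI sLM -eqV joing_subr.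
case/andP: ltL => _ /negP[]; rewrite -eqUL /=.
have nVL := subset_trans sLU (subset_trans (subsetIr _ _) nVU).
by rewrite norm_joinEr // -group_modr // mul_subG.
Qed.

(** The last clause yields the strict drop: starting from [V = 1] and ending at [G], the series must
    leave [M], and the factor where it does vanishes. *)
Lemma supplement_chief_series (c : seq {group gT}) V :
    V <| G -> G.-chief.-series V c ->
  exists c' : seq {group gT},
    [/\ M.-chief.-series (M :&: V)%G c',
        last (M :&: V)%G c' = (M :&: last V c)%G, size c' <= size c
      & V \subset M -> size c' < size c \/ last V c \subset M].
Proof.
elim: c V => [|U c IHc] V nsVG /=.
  by move=> _; exists [::]; split=> //; right.
case/andP=> chiefUV chief_c; have/andP[_ nsUG] := chiefUV.
have [c' [chief_c' last_c' le_c' eq_c']] := IHc U nsUG chief_c.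
have [[eqMUV nsUM] | [chiefMUV sVUM]] := supplement_chief_factor nsVG chiefUV.
  have eqG : (M :&: U)%G = (M :&: V)%G by apply: val_inj.
  rewrite eqG in chief_c' last_c'; exists c'; split=> //; first exact: leqW.
  by left.
exists ((M :&: U)%G :: c'); split=> //=; first by rewrite chiefMUV.
by move/sVUM/eq_c'.
Qed.

End Supplement.

Lemma sol_short_max_series G (c : seq {group gT}) :
    solvable G -> G.-chief.-series 1%G c -> last 1%G c = G ->
  exists s : seq {group gT},
    [/\ max_series s, last 1%G s = G & size s <= size c].
Proof.
have [n] := ubnP #|G|; elim: n G c => // n IHn G c leGn solG chief_c last_c.
have [/val_inj-> | ntG] := eqsVneq G 1; first by exists [::].
have [M maxM defG] := sol_maximal_Fitting_supplement solG ntG.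
have ltMG := maxgroupp maxM; have sMG := proper_sub ltMG.
have [c' [chief_c' last_c' _ eq_c']] := supplement_chief_series maxM
  (Fitting_normal G) (Fitting_nil G) defG (normal1 G) chief_c.
have ltc : size c' < size c.
  have [//|] := eq_c' (sub1G M); rewrite last_c => sGM.
  by rewrite properE sGM andbF in ltMG.
have M1 : (M :&: 1)%G = 1%G by apply/val_inj/setIidPr/sub1G.
have MG : (M :&: G)%G = M by apply/val_inj/setIidPl.
rewrite M1 last_c MG in chief_c' last_c'.
have [s [max_s last_s le_s]] := IHn M c' (leq_trans (proper_card ltMG) leGn)
  (solvableS sMG solG) chief_c' last_c'.
exists (rcons s G); rewrite last_rcons size_rcons; split=> //.
  by rewrite /max_series rcons_path last_s maxM andbT.
exact: leq_ltn_trans le_s ltc.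
Qed.

(** Jump counting bounds every modular chain, and the chief series, whose terms are normal, attains
    the bound. *)
Lemma modl_chief_length G (c : seq {group gT}) :
  G.-chief.-series 1%G c -> last 1%G c = G -> modl G = size c.
Proof.
move=> chief_c last_c; apply/eqP; rewrite eqn_leq; apply/andP; split.
  apply/bigmax_leqP=> C /andP[chC /forall_inP modC].
  have := card_modular_chain chief_c last_c chC modC.
  by rewrite /chain_length; case: #|C|.
have lt_c : path (fun H K => H \proper K) 1%G c.
  by apply: sub_path chief_c => H K /andP[/maxgroupp/andP[]].
have := proper_series_chain lt_c; rewrite last_c => chC.
have -> : size c = chain_length [set H in 1%G :: c].
  by rewrite /chain_length card_proper_series.
apply: leq_bigmax_cond; rewrite chC; apply/forall_inP=> H CH.
apply: normal_modular; have [[|i] lei ->] := mem_proper_series CH.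
  exact: normal1.
by have/(pathP 1%G)/(_ i lei)/andP[] := chief_c.
Qed.

End ChiefSeries.

Theorem theorem1p1 (gT : finGroupType) (G : {group gT}) :
  solvable G <-> minmaxl G = modl G.
Proof.
have [c chief_c last_c] := chief_series_exists (normal_refl G).
rewrite (modl_chief_length chief_c last_c).
rewrite /minmaxl; case: ex_minnP => m /exists_inP[C maxC /eqP lenC] minm.
have [s [max_s last_s cardC]] := max_chain_series maxC.
have{cardC lenC} eqm : size s = m by rewrite -lenC /chain_length cardC.
subst m.
rewrite -{1}last_s in chief_c.
split=> [solG | eqsc]; last first.
  have := chief_series_eq_sol max_s chief_c; rewrite last_s last_c eqsc.
  exact.
have le_cs : size c <= size s.
  by apply: (chief_series_le max_s chief_c); rewrite last_s.
rewrite last_s in chief_c.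
have [s' [max_s' last_s' le_s']] := sol_short_max_series solG chief_c last_c.
have [C' maxC' cardC'] := series_max_chain max_s'; rewrite last_s' in maxC'.
apply/eqP; rewrite eqn_leq le_cs andbT; apply: leq_trans le_s'; apply: minm.
by apply/existsP; exists C'; rewrite maxC' /chain_length cardC' eqxx.
Qed.
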